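(* Let $j\in\mathbb{Z}$ and let $n$ be a two-dimensional real-valued, zero-mean, wide-sense stationary random field. For all $\mathbf m=(m_1,m_2)\in\{1,\ldots,M-1\}^2$, define, for all $\mathbf k\in\mathbb{Z}^2$, $$w_{j,\mathbf m}[\mathbf k]=\frac1{\sqrt2}\big(n_{j,\mathbf m}[\mathbf k]+n^{\mathrm H}_{j,\mathbf m}[\mathbf k]\big),\qquad w^{\mathrm H}_{j,\mathbf m}[\mathbf k]=\frac1{\sqrt2}\big(n_{j,\mathbf m}[\mathbf k]-n^{\mathrm H}_{j,\mathbf m}[\mathbf k]\big).$$ Then, for all $\mathbf m\in\{1,\ldots,M-1\}^2$ and $\boldsymbol\ell\in\mathbb{Z}^2$, $$\Gamma_{w_{j,\mathbf m},w_{j,\mathbf m}}[\boldsymbol\ell]=\Gamma_{n_{j,\mathbf m},n_{j,\mathbf m}}[\boldsymbol\ell]+\Gamma_{n_{j,\mathbf m},n^{\mathrm H}_{j,\mathbf m}}[\boldsymbol\ell],$$ $$\Gamma_{w^{\mathrm H}_{j,\mathbf m},w^{\mathrm H}_{j,\mathbf m}}[\boldsymbol\ell]=\Gamma_{n_{j,\mathbf m},n_{j,\mathbf m}}[\boldsymbol\ell]-\Gamma_{n_{j,\mathbf m},n^{\mathrm H}_{j,\mathbf m}}[\boldsymbol\ell],$$ $$\Gamma_{w_{j,\mathbf m},w^{\mathrm H}_{j,\mathbf m}}[\boldsymbol\ell]=0.$$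
   Context: Fourier transform: $\widehat a(\omega)=\int a(t)e^{-\imath\omega t}dt$. $M\ge 2$ is an integer. $M$-band dual-tree wavelets: $\psi_0\in \mathrm L^2(\mathbb{R})$ is the (real-valued) scaling function and $\psi_1,\ldots,\psi_{M-1}\in \mathrm L^2(\mathbb{R})$ are the (real-valued) mother wavelets of an orthonormal $M$-band multiresolution analysis; in particular the functions $M^{-j/2}\psi_m(M^{-j}t-k)$, $1\le m\le M-1$, $j,k\in\mathbb{Z}$, form an orthonormal basis of $\mathrm L^2(\mathbb{R})$. For $m\in\{1,\ldots,M-1\}$ the dual wavelet $\psi^{\mathrm H}_m$ is the Hilbert transform of $\psi_m$: $\widehat\psi{}_m^{\mathrm H}(\omega)=-\imath\,\mathrm{sign}(\omega)\widehat\psi_m(\omega)$. Autocovariance of $n$: $\Gamma_n(\boldsymbol\tau)=\mathsf{E}\{n(\mathbf x+\boldsymbol\tau)n(\mathbf x)\}$ for all $\boldsymbol\tau,\mathbf x\in\mathbb{R}^2$. Cross-correlation of real-valued $f,g\in \mathrm L^2(\mathbb{R})$: $\gamma_{f,g}(\tau)=\int_{-\infty}^\infty f(x)g(x-\tau)\,dx$. Separable 2D coefficients, for $\mathbf m=(m_1,m_2)$ and $\mathbf k=(k_1,k_2)\in\mathbb{Z}^2$: $n_{j,\mathbf m}[\mathbf k]=\int\int n(x_1,x_2)M^{-j}\psi_{m_1}(M^{-j}x_1-k_1)\psi_{m_2}(M^{-j}x_2-k_2)\,dx_1dx_2$, and $n^{\mathrm H}_{j,\mathbf m}[\mathbf k]$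 is defined in the same way with $\psi_{m_1},\psi_{m_2}$ replaced by $\psi^{\mathrm H}_{m_1},\psi^{\mathrm H}_{m_2}$. For two random fields $u,v$ indexed by $\mathbb{Z}^2$, $\Gamma_{u,v}[\boldsymbol\ell]=\mathsf{E}\{u[\mathbf k+\boldsymbol\ell]v[\mathbf k]\}$ (independent of $\mathbf k$). It is assumed throughout that expectation and integrals may be exchanged (Fubini: $n$ is jointly measurable and the corresponding integrals of $\mathsf{E}\{|n(\mathbf x)n(\mathbf x')|\}$ against the absolute values of the two analyzing functions, primal or dual, are finite), so that with $\boldsymbol\ell=(\ell_1,\ell_2)$ the covariance fields are given by absolutely convergent integrals: $\Gamma_{n_{j,\mathbf m},n_{j,\mathbf m}}[\boldsymbol\ell]=\int\int\Gamma_n(x_1,x_2)\gamma_{\psi_{m_1},\psi_{m_1}}(M^{-j}x_1-\ell_1)\gamma_{\psi_{m_2},\psi_{m_2}}(M^{-j}x_2-\ell_2)dx_1dx_2$; $\Gamma_{n^{\mathrm H}_{j,\mathbf m},n^{\mathrm H}_{j,\mathbf m}}[\boldsymbol\ell]$ is given by the same formula with $\gamma_{\psi^{\mathrm H}_{m_i},\psi^{\mathrm H}_{m_i}}$ in place of $\gamma_{\psi_{m_i},\psi_{m_i}}$, and $\Gamma_{n_{j,\mathbf m},n^{\mathrm H}_{j,\mathbf m}}[\boldsymbol\ell]$ by the same formula with $\gamma_{\psi_{m_i},\psi^{\mathrm H}_{m_i}}$. *)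

(* Defs.v *)
From HB Require Import structures.
From mathcomp Require Import all_boot all_order all_algebra.
From mathcomp Require Import complex.
From mathcomp Require Import all_classical all_reals all_analysis.
Set Implicit Arguments.
Unset Strict Implicit.
Unset Printing Implicit Defensive.
Import Order.TTheory GRing.Theory Num.Theory.
Import numFieldNormedType.Exports.
Local Open Scope classical_set_scope.
Local Open Scope ring_scope.
Local Open Scope complex_scope.

(* Elements of L2 are represented by Borel measurable functions rather than by
   almost-everywhere classes; the notions on them are invariant under
   modification on a Lebesgue-null set. *)
Notation leb R := (@lebesgue_measure R).
Notation leb2 R := (@lebesgue_measure R \x @lebesgue_measure R)%E.

Definition L2 (R : realType) : set (R -> R) :=
  [set f | f \in Lfun (leb R) 2%:E].

Definition L2dist (R : realType) (f g : R -> R) : \bar R :=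
  ('N[leb R]_2%:E[EFin \o (f \- g)%R])%E.

Definition inner (R : realType) (f g : R -> R) : R :=
  \int[leb R]_x (f x * g x).

Definition orthonormal_family (R : realType) (I : eqType) (e : I -> R -> R) : Prop :=
  (forall i, L2 (e i)) /\ forall i i', inner (e i) (e i') = (i == i')%:R.

Definition closed_span (R : realType) (I : Type) (e : I -> R -> R) :
    set (R -> R) :=
  [set f | L2 f /\ forall eps : R, 0 < eps -> exists s : seq (R * I),
    (L2dist f (fun x => \sum_(p <- s) p.1 * e p.2 x)%R < eps%:E)%E].

Definition translates (R : realType) (f : R -> R) (k : int) : R -> R :=
  fun x => f (x - k%:~R).

(* Indexed by the pairs (m - 1, k), 1 <= m <= M - 1. *)
Definition wavelet_translates (R : realType) (M : nat) (psi : nat -> R -> R)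
    (i : 'I_M.-1 * int) : R -> R :=
  translates (psi i.1.+1) i.2.

(* Approximation space V_j, the closed span of the functions
   M^(-j/2) psi0 (M^-j x - k), k in Z; the resolution gets coarser as j grows. *)
Definition approx_space (R : realType) (M : nat) (psi0 : R -> R) (j : int) :
    set (R -> R) :=
  [set f | closed_span (translates psi0) (fun x => f ((M%:R : R) ^ j * x))].

(* psi 0 is the scaling function and psi 1, ..., psi (M - 1) are the mother
   wavelets of an orthonormal M-band multiresolution analysis of L2; the values
   psi m with m >= M play no role. *)
Record orthonormal_mra (R : realType) (M : nat) (psi : nat -> R -> R) : Prop :=
  OrthonormalMRA {
    mra_scaling : orthonormal_family (translates (psi 0%N));
    mra_nested : forall j : int,
      approx_space M (psi 0%N) j `<=` approx_space M (psi 0%N) (j - 1);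
    mra_separated : forall f : R -> R,
      (forall j : int, approx_space M (psi 0%N) j f) ->
      {ae leb R, forall x, f x = 0};
    mra_dense : forall (f : R -> R) (eps : R), L2 f -> 0 < eps ->
      exists (j : int) (g : R -> R), approx_space M (psi 0%N) j g /\
        (L2dist f g < eps%:E)%E;
    mra_wavelets : orthonormal_family (wavelet_translates (M := M) psi);
    (* the wavelets span the orthogonal complement of V_0 in V_(-1) *)
    mra_detail : closed_span (wavelet_translates (M := M) psi) =
      [set f | approx_space M (psi 0%N) (- 1) f /\
        forall g, approx_space M (psi 0%N) 0 g -> inner f g = 0]
  }.

Definition expi (R : realType) (x : R) : R[i] := cos x +i* sin x.

Definition cintegral (R : realType) (D : set R) (f : R -> R[i]) : R[i] :=
  (\int[leb R]_(x in D) complex.Re (f x)) +i*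
  (\int[leb R]_(x in D) complex.Im (f x)).

(* A function of L2 need not be integrable, so its Fourier transform is the limit
   in L2 of the truncated integrals of f t * exp (- i w t) over [-A, A]. *)
Definition truncated_fourier (R : realType) (f : R -> R) (A w : R) : R[i] :=
  cintegral `[- A, A] (fun t => (f t)%:C * expi (- (w * t))).

Definition is_fourier (R : realType) (f : R -> R) (F : R -> R[i]) : Prop :=
  [/\ L2 f,
      L2 (fun w => complex.Re (F w)),
      L2 (fun w => complex.Im (F w)) &
      (\int[leb R]_w
         ((complex.Re (truncated_fourier f A w - F w)) ^+ 2 +
          (complex.Im (truncated_fourier f A w - F w)) ^+ 2)%:E)%E
        @[A --> +oo%R] --> 0%E].

(* fH is a (real-valued) representative of the Hilbert transform of f. *)
Definition is_hilbert_transform (R : realType) (f fH : R -> R) : Prop :=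
  exists F FH : R -> R[i],
    [/\ is_fourier f F, is_fourier fH FH &
        {ae leb R, forall w, FH w = - 'i%C * (Num.sg w)%:C * F w}].

(* E[u(l + k) v(k)] at k = 0; this is the covariance field of u and v when it
   does not depend on k. *)
Definition cov (R : realType) (d : measure_display) (T : measurableType d)
    (P : probability T R) (I : zmodType) (u v : I -> T -> R) (l : I) : \bar R :=
  'E_P[fun t => (u l t * v 0 t)%R]%E.

Definition cov_stationary (R : realType) (d : measure_display)
    (T : measurableType d) (P : probability T R) (I : zmodType)
    (u v : I -> T -> R) : Prop :=
  forall k l : I, 'E_P[fun t => (u (k + l) t * v k t)%R]%E = cov P u v l.

Definition wide_sense_stationary (R : realType) (d : measure_display)
    (T : measurableType d) (P : probability T R) (I : zmodType)
    (u : I -> T -> R) : Prop :=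
  [/\ forall x, u x \in Lfun P 2%:E,
      forall x y, ('E_P[u x] = 'E_P[u y])%E &
      cov_stationary P u u].

(* Separable analyzing function
   M^-j f1(M^-j x1 - k1) f2(M^-j x2 - k2). *)
Definition analyzing (R : realType) (M : nat) (j : int) (f1 f2 : R -> R)
    (k : int * int) (x : R * R) : R :=
  (M%:R : R) ^ (- j) * f1 ((M%:R : R) ^ (- j) * x.1 - k.1%:~R)
                     * f2 ((M%:R : R) ^ (- j) * x.2 - k.2%:~R).

(* Defined for every t; the integral is absolutely convergent only almost surely,
   and the value on the exceptional null set is irrelevant. *)
Definition coef (R : realType) (d : measure_display) (T : measurableType d)
    (n : R * R -> T -> R) (M : nat) (j : int) (f1 f2 : R -> R)
    (k : int * int) (t : T) : R :=
  \int[leb2 R]_x (n x t * analyzing M j f1 f2 k x).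

Definition jointly_measurable (R : realType) (d : measure_display)
    (T : measurableType d) (n : R * R -> T -> R) : Prop :=
  measurable_fun [set: (measurableTypeR R * measurableTypeR R) * T]
    (fun p => n p.1 p.2).

(* Absolute integrability that justifies exchanging expectation and integrals. *)
Definition fubini_condition (R : realType) (d : measure_display)
    (T : measurableType d) (P : probability T R) (n : R * R -> T -> R)
    (phi phi' : R * R -> R) : Prop :=
  (\int[leb2 R]_x \int[leb2 R]_y
     ('E_P[fun t => `|n x t * n y t|%R] * (`|phi x| * `|phi' y|)%:E) < +oo)%E.

(* Main.v *)
Require Import Defs.
From HB Require Import structures.
From mathcomp Require Import all_boot all_order all_algebra.
From mathcomp Require Import complex.
From mathcomp Require Import ring lra.
From mathcomp Require Import all_classical all_reals all_analysis.
From mathcomp Require Import measurable_realfun.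
Import Order.TTheory GRing.Theory Num.Theory.
Import numFieldNormedType.Exports.
Local Open Scope classical_set_scope.
Local Open Scope ring_scope.

(** Write corr f g s for the integral of f (y + s) * g y.  Stationarity turns the
    covariance of the coefficients of n on two separable analyzing functions
    into an integral, over the lag z, of the autocovariance of n at z times
    corr f1 g1 * corr f2 g2, taken at points that depend on z and on the
    difference of the two positions only (second_moment_Fubini,
    covariance_formula, coef_moment).  In particular the coefficients are jointly
    stationary, and everything else follows from two identities between
    correlations of a function f and its Hilbert transform fH (corr_hilbert):

      corr fH fH = corr f f    and    corr fH f = - corr f fH.

    The first makes the primal and the dual coefficients have the same
    autocovariance A.  By the second, exchanging the primal and the dual field
    in their cross-covariance B introduces one minus sign per coordinate, so B
    does not change.  Expanding the products of x + y and x - y, the covariances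
    of w and wH are then (2 A + 2 B) / 2 and (2 A - 2 B) / 2, and their
    cross-covariance is (A - B + B - A) / 2 = 0 (integral_packet_mul).

    Both identities are read off Plancherel's formula (plancherel_corr)

      2 pi * corr f g s = integral of Re (F w * conj (G w) * exp (i s w)),

    since FH = - i sgn F almost everywhere gives FH conj FH = F conj F and
    FH conj F = - F conj FH.

    The Fourier transform of an L2 function is here the L2 limit of the
    transforms of its restrictions to [-n, n], so Plancherel's formula is first
    proved for these restrictions (parseval_cutoff).  The transform of their
    correlation h is the integrand of the right-hand side (the convolution
    theorem, cos_transform_corr); it is integrable, as a sum of products of
    square-integrable functions, and h is bounded, integrable and continuous
    (continuous_corr), so that the formula is Fourier inversion for h
    (fourier_inversion), obtained by Abel summation with the Poisson kernel.
    Letting n tend to infinity gives the general case. *)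

Set Implicit Arguments.
Unset Strict Implicit.
Unset Printing Implicit Defensive.

(** * Integration of real-valued functions *)

Section real_integration.
Context d (T : measurableType d) (R : realType).
Variable mu : {measure set T -> \bar R}.
Implicit Types f g h : T -> R.

Lemma integrable_measurable f :
  mu.-integrable setT (EFin \o f) -> measurable_fun setT f.
Proof. by move=> /(measurable_int mu)/measurable_EFinP. Qed.

Lemma integrable_addr f g : mu.-integrable setT (EFin \o f) ->
  mu.-integrable setT (EFin \o g) ->
  mu.-integrable setT (EFin \o (fun x => f x + g x)).
Proof. by move=> fi gi; exact: (integrableD measurableT fi gi). Qed.

Lemma integrable_mulrl (k : R) f : mu.-integrable setT (EFin \o f) ->
  mu.-integrable setT (EFin \o (fun x => k * f x)).
Proof. by move=> fi; exact: (integrableZl measurableT k fi). Qed.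

Lemma integrable_subr f g : mu.-integrable setT (EFin \o f) ->
  mu.-integrable setT (EFin \o g) ->
  mu.-integrable setT (EFin \o (fun x => f x - g x)).
Proof. by move=> fi gi; exact: (integrableB measurableT fi gi). Qed.

Lemma integrable_bounded_mul f (b : T -> R) (B : R) : mu.-integrable setT (EFin \o f) ->
  measurable_fun setT b -> (forall x, `|b x| <= B) ->
  mu.-integrable setT (EFin \o (fun x => f x * b x)).
Proof.
move=> fi mb bB; have := integrableZl measurableT B fi.
apply: le_integrable => //.
  by apply/measurable_EFinP/measurable_funM => //; exact: integrable_measurable.
move=> x _; suff : `|f x * b x| <= `|B * f x| by rewrite -lee_fin.
by rewrite normrM [leRHS]normrM mulrC ler_wpM2r// (le_trans (bB x))// ler_norm.
Qed.

Lemma ae_real_dominated_convergence (f_ : (T -> R)^nat) f g :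
  (forall n, measurable_fun setT (f_ n)) -> measurable_fun setT f ->
  {ae mu, forall x, f_ n x @[n --> \oo] --> f x} ->
  mu.-integrable setT (EFin \o g) ->
  (forall n x, `|f_ n x| <= g x) ->
  \int[mu]_x f_ n x @[n --> \oo] --> \int[mu]_x f x.
Proof.
move=> mf_ mf cf ig fg.
have [] := @dominated_convergence _ T R mu setT measurableT
  (fun n => EFin \o f_ n) (EFin \o f) (EFin \o g).
- by move=> n; exact/measurable_EFinP.
- exact/measurable_EFinP.
- by apply: filterS cf => x cx _ /=; apply: cvg_EFin; [exact: nearW|exact: cx].
- exact: ig.
- by apply: aeW => x n _ /=; rewrite lee_fin.
- move=> fi _ cvf.
  apply: fine_cvg; rewrite fineK//.
  exact: integrable_fin_num.
Qed.

Lemma real_dominated_convergence (f_ : (T -> R)^nat) f g :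
  (forall n, measurable_fun setT (f_ n)) ->
  (forall x, f_ n x @[n --> \oo] --> f x) ->
  mu.-integrable setT (EFin \o g) ->
  (forall n x, `|f_ n x| <= g x) ->
  \int[mu]_x f_ n x @[n --> \oo] --> \int[mu]_x f x.
Proof.
move=> mf_ cf; apply: ae_real_dominated_convergence => //; last exact: aeW.
by apply: (measurable_fun_cvg (h := f_)) => // x _; exact: cf.
Qed.

Lemma Lfun2P f : f \in Lfun mu 2%:E <->
  measurable_fun setT f /\ mu.-integrable setT (EFin \o (fun x => f x ^+ 2)).
Proof.
split=> [f2|[mf fi]].
  split; last exact: Lfun2_integrable_sqr.
  by move: f2; rewrite inE => /andP[]; rewrite inE.
rewrite inE; apply/andP; split; rewrite inE//=.
rewrite /finite_norm unlock /Lnorm poweR_lty//.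
move/integrableP : fi => [_]; apply: le_lt_trans.
rewrite le_eqVlt; apply/orP; left; apply/eqP; apply: eq_integral => x _ /=.
rewrite powR_mulrn//.
by rewrite normrX.
Qed.

Lemma Lfun2_mul f g : f \in Lfun mu 2%:E -> g \in Lfun mu 2%:E ->
  mu.-integrable setT (EFin \o (fun x => f x * g x)).
Proof. by move=> f2 g2; apply/Lfun1_integrable; exact: Lfun2_mul_Lfun1. Qed.

Lemma Lfun2_le f g : f \in Lfun mu 2%:E -> measurable_fun setT g ->
  (forall x, `|g x| <= `|f x|) -> g \in Lfun mu 2%:E.
Proof.
move=> /Lfun2P[mf fi] mg gf; apply/Lfun2P; split => //.
apply: le_integrable fi => //; first exact/measurable_EFinP/measurable_funX.
by move=> x _; rewrite lee_fin !normrX ler_pXn2r// nnegrE.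
Qed.

Definition sqnorm f : R := \int[mu]_x (f x ^+ 2).

Lemma sqnorm_ge0 f : 0 <= sqnorm f.
Proof. by apply: Rintegral_ge0 => x _; exact: sqr_ge0. Qed.

(** The discriminant of the nonnegative quadratic t |-> ||f + t g||^2 is
    nonpositive. *)
Lemma cauchy_schwarz f g : f \in Lfun mu 2%:E -> g \in Lfun mu 2%:E ->
  `|\int[mu]_x (f x * g x)| <= Num.sqrt (sqnorm f) * Num.sqrt (sqnorm g).
Proof.
move=> f2 g2; have [_ ff] := (Lfun2P f).1 f2; have [_ gg] := (Lfun2P g).1 g2.
have fg := Lfun2_mul f2 g2; set b := \int[mu]_x (f x * g x).
have pos t : 0 <= sqnorm f + (2 * t * b + t ^+ 2 * sqnorm g).
  have -> : sqnorm f + (2 * t * b + t ^+ 2 * sqnorm g) =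
            \int[mu]_x ((f x + t * g x) ^+ 2).
    have fg' := integrable_mulrl (2 * t) fg.
    have gg' := integrable_mulrl (t ^+ 2) gg.
    rewrite /b /sqnorm -!RintegralZl// -RintegralD// -RintegralD//; last first.
      exact: integrable_addr.
    by apply: eq_Rintegral => x _; ring.
  by apply: Rintegral_ge0 => x _; exact: sqr_ge0.
rewrite -sqrtrM ?sqnorm_ge0// -sqrtr_sqr ler_wsqrtr//.
have [g0|g0] := eqVneq (sqnorm g) 0.
  rewrite g0 mulr0; have [->|b0] := eqVneq b 0; first by rewrite expr0n.
  (* The quadratic is now affine in t, and this t gives it the value -1. *)
  have := pos (- (sqnorm f + 1) / (2 * b)).
  rewrite g0 mulr0 addr0 (_ : 2 * _ * b = - (sqnorm f + 1)); last by field.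
  by move=> h; exfalso; lra.
have gp : 0 < sqnorm g by rewrite lt_neqAle eq_sym g0 sqnorm_ge0.
(* The minimum of the quadratic. *)
have := pos (- b / sqnorm g).
rewrite (_ : _ + _ = (sqnorm f * sqnorm g - b ^+ 2) / sqnorm g); last by field.
by rewrite pmulr_lge0 ?invr_gt0// subr_ge0.
Qed.

End real_integration.

Section real_fubini.
Context d1 d2 (T1 : measurableType d1) (T2 : measurableType d2) (R : realType).
Variable m1 : {sigma_finite_measure set T1 -> \bar R}.
Variable m2 : {sigma_finite_measure set T2 -> \bar R}.
Variable f : T1 * T2 -> R.

(** A partial integral is the finite part of a difference of two Tonelli
    integrals, which is measurable whether or not the sections are integrable. *)
Lemma measurable_Rintegral1 : measurable_fun setT f ->
  measurable_fun setT (fun x => \int[m2]_y f (x, y)).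
Proof.
move=> /measurable_EFinP mf.
apply: (measurableT_comp (fine_measurable measurableT)).
under eq_fun do rewrite integralE.
apply: emeasurable_funB.
- rewrite (_ : (fun _ => _) = fubini_F m2 (EFin \o f)^\+%E).
    by apply: measurable_fun_fubini_tonelli_F => //; exact: measurable_funepos.
  by apply/funext => z; apply: eq_integral => t _; rewrite !funeposE.
- rewrite (_ : (fun _ => _) = fubini_F m2 (EFin \o f)^\-%E).
    by apply: measurable_fun_fubini_tonelli_F => //; exact: measurable_funeneg.
  by apply/funext => z; apply: eq_integral => t _; rewrite !funenegE.
Qed.

Lemma measurable_Rintegral2 : measurable_fun setT f ->
  measurable_fun setT (fun y => \int[m1]_x f (x, y)).
Proof.
move=> /measurable_EFinP mf.
apply: (measurableT_comp (fine_measurable measurableT)).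
under eq_fun do rewrite integralE.
apply: emeasurable_funB.
- rewrite (_ : (fun _ => _) = fubini_G m1 (EFin \o f)^\+%E).
    by apply: measurable_fun_fubini_tonelli_G => //; exact: measurable_funepos.
  by apply/funext => z; apply: eq_integral => t _; rewrite !funeposE.
- rewrite (_ : (fun _ => _) = fubini_G m1 (EFin \o f)^\-%E).
    by apply: measurable_fun_fubini_tonelli_G => //; exact: measurable_funeneg.
  by apply/funext => z; apply: eq_integral => t _; rewrite !funenegE.
Qed.

Hypothesis fi : (m1 \x m2)%E.-integrable setT (EFin \o f).

(** The inner integral may be infinite on a null set of x, where its finite part
    is meaningless; neither side sees this set. *)
Lemma real_fubini1 :
  m1.-integrable setT (EFin \o (fun x => \int[m2]_y f (x, y))) /\
  \int[m1]_x \int[m2]_y f (x, y) =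
  fine (\int[m1]_x \int[m2]_y (f (x, y))%:E)%E.
Proof.
have Fi := integrable_fubini_F fi.
have ae : ae_eq m1 setT (fubini_F m2 (EFin \o f))
    (EFin \o (fun x => \int[m2]_y f (x, y))).
  apply: filterS (integrable_ae measurableT Fi) => x /(_ I) Fx _ /=.
  by rewrite /fubini_F/= in Fx *; rewrite fineK.
have mF : measurable_fun setT (EFin \o (fun x => \int[m2]_y f (x, y))).
  apply/measurable_EFinP; apply: measurable_Rintegral1.
  exact: integrable_measurable fi.
split.
  apply/integrableP; split => //.
  move/integrableP : Fi => [mFi]; apply: le_lt_trans.
  rewrite le_eqVlt; apply/orP; left; apply/eqP/ae_eq_integral => //;
    [exact: measurableT_comp|exact: measurableT_comp|].
  by apply: filterS ae => x h _ /=; rewrite h.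
congr fine.
by apply/esym/ae_eq_integral => //; exact: measurable_int Fi.
Qed.

End real_fubini.

Section real_fubini_swap.
Context d1 d2 (T1 : measurableType d1) (T2 : measurableType d2) (R : realType).
Variable m1 : {sigma_finite_measure set T1 -> \bar R}.
Variable m2 : {sigma_finite_measure set T2 -> \bar R}.
Variable f : T1 * T2 -> R.
Hypothesis fi : (m1 \x m2)%E.-integrable setT (EFin \o f).

Lemma integrable_prod_swap :
  (m2 \x m1)%E.-integrable setT (EFin \o (fun p => f (p.2, p.1))).
Proof.
have mf := measurable_int _ fi.
apply/integrable12ltyP; last exact: (integrable21ltyP m1 m2 mf).1 fi.
exact: (measurableT_comp mf (measurable_fun_pair
  (@measurable_snd _ _ T2 T1) (@measurable_fst _ _ T2 T1))).
Qed.

Lemma real_fubini2 :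
  m2.-integrable setT (EFin \o (fun y => \int[m1]_x f (x, y))).
Proof. exact: (real_fubini1 integrable_prod_swap).1. Qed.

Lemma real_fubini :
  \int[m1]_x \int[m2]_y f (x, y) = \int[m2]_y \int[m1]_x f (x, y).
Proof.
rewrite (real_fubini1 fi).2 (real_fubini1 integrable_prod_swap).2/=.
by rewrite (Fubini fi).
Qed.

End real_fubini_swap.

(** * Products of functions of one variable each *)

Section product_functions.
Context d1 d2 (T1 : measurableType d1) (T2 : measurableType d2) (R : realType).
Variable m1 : {sigma_finite_measure set T1 -> \bar R}.
Variable m2 : {sigma_finite_measure set T2 -> \bar R}.

Lemma ge0_integral_prod_mul (u : T1 -> R) (v : T2 -> R) :
  measurable_fun setT u -> measurable_fun setT v ->
  (\int[m1]_x \int[m2]_y `|(u x * v y)%:E| =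
   (\int[m1]_x `|(u x)%:E|) * (\int[m2]_y `|(v y)%:E|))%E.
Proof.
move=> mu mv; rewrite muleC -ge0_integralZl//; last 2 first.
- by apply: measurableT_comp => //; exact/measurable_EFinP.
- exact: integral_ge0.
apply: eq_integral => x _; rewrite muleC -ge0_integralZl//.
  by apply: eq_integral => y _; rewrite /= normrM EFinM.
by apply: measurableT_comp => //; exact/measurable_EFinP.
Qed.

Lemma integrable_prod (g : T1 -> R) (h : T2 -> R) :
  m1.-integrable setT (EFin \o g) -> m2.-integrable setT (EFin \o h) ->
  (m1 \x m2)%E.-integrable setT (EFin \o (fun p => g p.1 * h p.2)).
Proof.
move=> gi hi.
have mg := integrable_measurable gi; have mh := integrable_measurable hi.
apply/integrable12ltyP.
  apply/measurable_EFinP.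
  by apply: measurable_funM; exact: measurableT_comp.
move/integrableP : (gi) => [_ gy]; move/integrableP : (hi) => [_ hy].
rewrite -[X in (X < _)%E]/(\int[m1]_x \int[m2]_y `|(g x * h y)%:E|)%E.
rewrite ge0_integral_prod_mul//.
by rewrite lte_mul_pinfty ?ge0_fin_numE//; exact: integral_ge0.
Qed.

End product_functions.

Lemma integrable_prod_dominated d1 d2 (T1 : measurableType d1)
    (T2 : measurableType d2) (R : realType)
    (m1 : {sigma_finite_measure set T1 -> \bar R})
    (m2 : {sigma_finite_measure set T2 -> \bar R})
    (f : T1 * T2 -> R) (g : T1 -> R) (h : T2 -> R) :
  measurable_fun setT f ->
  m1.-integrable setT (EFin \o g) -> m2.-integrable setT (EFin \o h) ->
  (forall x y, `|f (x, y)| <= `|g x * h y|) ->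
  (m1 \x m2)%E.-integrable setT (EFin \o f).
Proof.
move=> mf gi hi fgh; apply: le_integrable (integrable_prod gi hi) => //.
  exact: (measurableT_comp _ mf).
by move=> [x y] _; rewrite lee_fin.
Qed.

(** * Affine changes of variable *)

Section affine_change_of_variable.
Context (R : realType).
Variables (a b : R) (a0 : 0 < a).
Let phi : measurableTypeR R -> measurableTypeR R := fun x => a * x + b.

Let mphi : measurable_fun setT phi.
Proof.
apply: continuous_measurable_fun => x.
by apply: cvgD; [apply: cvgM; [exact: cvg_cst|exact: cvg_id]|exact: cvg_cst].
Qed.

Let a_nneg : {nonneg R} := NngNum (ltW a0).

Let image : {measure set (measurableTypeR R) -> \bar R} :=
  measure_function_pushforward__canonical__measure_function_Measure (leb R) mphi.

(** Both sides are measures, and they agree on half-open intervals. *)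
Let lebesgue_affine (A : set R) : measurable A ->
  leb R A = mscale a_nneg image A.
Proof.
move=> mA; have := @lebesgue_measure_unique R (mscale a_nneg image).
apply=> // _ [[l r]] _ <- /=.
change (leb R `]l, r] = a%:E * leb R (phi @^-1` `]l, r]%classic))%E.
have -> : phi @^-1` `]l, r] = `](l - b) / a, (r - b) / a]%classic.
  apply/seteqP; split=> x; rewrite /phi/= !in_itv/=.
    by rewrite ltr_pdivrMr// ler_pdivlMr// ltrBlDr lerBrDr mulrC.
  by rewrite ltr_pdivrMr// ler_pdivlMr// ltrBlDr lerBrDr mulrC.
rewrite !lebesgue_measure_itv/= !lte_fin ltr_pM2r ?invr_gt0// ltrD2r.
case: ifPn => _; last by rewrite mule0.
by rewrite -!EFinB -EFinM; congr EFin; field; rewrite gt_eqF.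
Qed.

Lemma ge0_integral_affine (F : R -> \bar R) : measurable_fun setT F ->
  (forall x, 0 <= F x)%E ->
  (\int[leb R]_x F x = a%:E * \int[leb R]_x F (a * x + b)%R)%E.
Proof.
move=> mF F0.
rewrite (eq_measure_integral (mscale a_nneg image)); last first.
  by move=> A mA _; exact: lebesgue_affine.
rewrite ge0_integral_mscale//; congr (_ * _)%E.
by rewrite ge0_integral_pushforward.
Qed.

Lemma integrable_affine (F : R -> R) : (leb R).-integrable setT (EFin \o F) ->
  (leb R).-integrable setT (EFin \o (fun x => F (a * x + b))).
Proof.
move=> Fi; have mF := measurable_int _ Fi.
apply/integrableP; split; first exact: (measurableT_comp mF mphi).
move/integrableP : Fi => [_].
rewrite ge0_integral_affine//; last exact: measurableT_comp.
rewrite !ltey; apply: contra_neq => ->.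
by rewrite mulry gtr0_sg// mul1e.
Qed.

Lemma Rintegral_affine (F : R -> R) : (leb R).-integrable setT (EFin \o F) ->
  \int[leb R]_x F x = a * \int[leb R]_x F (a * x + b).
Proof.
move=> Fi; have mF := measurable_int _ Fi.
have Gi := integrable_affine Fi.
apply/EFin_inj; rewrite EFinM !fineK ?integrable_fin_num//.
have pos : (\int[leb R]_x (EFin \o F)^\+ x =
    a%:E * \int[leb R]_x (EFin \o (fun x => F (a * x + b)%R))^\+ x)%E.
  rewrite (ge0_integral_affine (measurable_funepos mF) (funepos_ge0 _)).
  by congr (_ * _)%E; apply: eq_integral => x _; rewrite !funeposE.
have neg : (\int[leb R]_x (EFin \o F)^\- x =
    a%:E * \int[leb R]_x (EFin \o (fun x => F (a * x + b)%R))^\- x)%E.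
  rewrite (ge0_integral_affine (measurable_funeneg mF) (funeneg_ge0 _)).
  by congr (_ * _)%E; apply: eq_integral => x _; rewrite !funenegE.
rewrite [LHS]integralE pos neg.
by rewrite -(muleBr _ (integrable_add_def measurableT Gi))// -integralE.
Qed.

End affine_change_of_variable.

(** * Transforms and the Poisson kernel *)

Section trigonometric_factors.
Context (R : realType).
Implicit Types (f : R -> R) (w t : R).

Lemma continuous_cosM w : continuous (fun t : R => cos (w * t)).
Proof.
move=> t; apply: (@continuous_comp _ _ _ (fun t : R => w * t) (@cos R)).
  exact: mulrl_continuous.
exact: continuous_cos.
Qed.

Lemma continuous_sinM w : continuous (fun t : R => sin (w * t)).
Proof.
move=> t; apply: (@continuous_comp _ _ _ (fun t : R => w * t) (@sin R)).
  exact: mulrl_continuous.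
exact: continuous_sin.
Qed.

Lemma measurable_cosM w : measurable_fun setT (fun t : R => cos (w * t)).
Proof. by apply: continuous_measurable_fun; exact: continuous_cosM. Qed.

Lemma measurable_sinM w : measurable_fun setT (fun t : R => sin (w * t)).
Proof. by apply: continuous_measurable_fun; exact: continuous_sinM. Qed.

Lemma integrable_mul_cos f w : (leb R).-integrable setT (EFin \o f) ->
  (leb R).-integrable setT (EFin \o (fun t => f t * cos (w * t))).
Proof.
move=> fi; apply: (integrable_bounded_mul fi (measurable_cosM w)) => t.
exact: cos_max.
Qed.

Lemma integrable_mul_sin f w : (leb R).-integrable setT (EFin \o f) ->
  (leb R).-integrable setT (EFin \o (fun t => f t * sin (w * t))).
Proof.
move=> fi; apply: (integrable_bounded_mul fi (measurable_sinM w)) => t.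
exact: sin_max.
Qed.

End trigonometric_factors.

Section poisson_kernel.
Context (R : realType).
Implicit Types v w x : R.

(** The Fourier transform of exp (- |w|), that is 2 pi times the Poisson kernel
    of the upper half-plane at height 1. *)
Definition poisson v : R := 2 / (1 + v ^+ 2).

Let D0 v : 1 + v ^+ 2 != 0 :> R.
Proof. by rewrite gt_eqF// ltr_pwDl// sqr_ge0. Qed.

Let exp_norm_continuous : continuous (fun w : R => expR (- `|w|)).
Proof.
move=> w; apply: (@continuous_comp _ _ _ (fun w : R => - `|w|) (@expR R)).
  by apply: cvgN; exact: norm_continuous.
exact: continuous_expR.
Qed.

(** A primitive of exp (- w) * (1 + cos (v w)) that vanishes at +oo. *)
Let F v w : R :=
  - (expR (- w) * (1 + (1 + v ^+ 2)^-1 * (cos (v * w) - v * sin (v * w)))).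

Let derive_F v w : is_derive w 1 (F v) (expR (- w) * (1 + cos (v * w))).
Proof.
have dl : is_derive w 1 (fun w : R => v * w) v.
  by apply: is_derive_eq; rewrite -[_ *: _]/(_ * _) mulr1.
have de : is_derive w 1 (fun w : R => expR (- w)) (- expR (- w)).
  have -> : - expR (- w) = expR (- w) * (- 1) by rewrite mulrN1.
  by apply: (is_derive1_comp (f := @expR R)).
have dc : is_derive w 1 (fun w : R => cos (v * w)) (- sin (v * w) * v).
  exact: (is_derive1_comp (f := @cos R) (g := fun w : R => v * w)).
have ds : is_derive w 1 (fun w : R => sin (v * w)) (cos (v * w) * v).
  exact: (is_derive1_comp (f := @sin R) (g := fun w : R => v * w)).
rewrite /F; apply: is_derive_eq.
rewrite -!/(_ * _) /GRing.scale/=.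
by field; exact: D0.
Qed.

(** Adding 1 to the cosine makes the integrand nonnegative, so that the improper
    integral is the increment of the primitive; parity gives the factor 2. *)
Lemma integral_exp_cos v :
  (\int[leb R]_w (expR (- `|w|) * (1 + cos (v * w)))%:E =
   (2 + poisson v)%:E)%E.
Proof.
have c1 : continuous (fun w : R => expR (- `|w|) * (1 + cos (v * w))).
  move=> w; apply: cvgM; first exact: exp_norm_continuous.
  by apply: cvgD; [exact: cvg_cst|exact: continuous_cosM].
have pos x y : 0 <= expR x * (1 + cos y) :> R.
  by rewrite mulr_ge0 ?expR_ge0// -lerBlDl sub0r cos_geN1.
have cF : continuous (F v).
  move=> w; apply: differentiable_continuous; apply/derivable1_diffP.
  by case: (derive_F v w).
rewrite ge0_symfun_integralT; last 3 first.
- by move=> w; exact: pos.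
- exact: c1.
- by move=> w /=; rewrite normrN mulrN cosN.
rewrite -set_itvcy.
rewrite [X in (_ * X)%E](_ : _ = \int[leb R]_(w in `[0%R, +oo[)
    (expR (- w) * (1 + cos (v * w)))%:E)%E; last first.
  apply: eq_integral.
  by move=> w; rewrite inE/= in_itv/= andbT => w0; rewrite ger0_norm.
rewrite (@ge0_continuous_FTC2y R _ (F v) 0 0).
- have -> : F v 0 = - (1 + (1 + v ^+ 2)^-1).
    by rewrite /F oppr0 expR0 mulr0 cos0 sin0 mulr0 subr0 mulr1 mul1r.
  by rewrite -EFinB -EFinM /poisson; congr EFin; field.
- by move=> w _.
- apply: continuous_subspaceT => w; apply: cvgM.
    apply: (@continuous_comp _ _ _ (@GRing.opp R) (@expR R)).
      exact: opp_continuous.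
    exact: continuous_expR.
  by apply: cvgD; [exact: cvg_cst|exact: continuous_cosM].
(* C bounds the parenthesis multiplying exp (- w) in F v w. *)
- pose C := 1 + (1 + v ^+ 2)^-1 * (1 + `|v|).
  apply: (@squeeze_cvgr _ _ _ _ (fun w => - (C * expR (- w)))
    (fun w => C * expR (- w))).
  + apply: nearW => w; rewrite -ler_norml /F normrN normrM.
    rewrite ger0_norm ?expR_ge0// mulrC ler_wpM2r ?expR_ge0//.
    rewrite (le_trans (ler_normD _ _))// normr1 lerD2l normrM.
    rewrite ger0_norm ?invr_ge0 ?addr_ge0 ?sqr_ge0// ler_wpM2l//.
      by rewrite ?invr_ge0 ?addr_ge0 ?sqr_ge0.
    rewrite (le_trans (ler_normB _ _))// lerD ?cos_max// normrM.
    by rewrite -[leRHS]mulr1 ler_wpM2l// sin_max.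
  + rewrite -[X in _ --> X]oppr0 -(mulr0 C).
    by apply: cvgN; apply: cvgM; [exact: cvg_cst|exact: cvgr_expR].
  + rewrite -[X in _ --> X](mulr0 C).
    by apply: cvgM; [exact: cvg_cst|exact: cvgr_expR].
- by move=> w _; case: (derive_F v w).
- by apply: cvg_at_right_filter; exact: cF.
- by move=> w _; rewrite derive1E; have [_ ->] := derive_F v w.
Qed.

Lemma integrable_exp_norm :
  (leb R).-integrable setT (EFin \o (fun w => expR (- `|w|))).
Proof.
apply/integrableP; split.
  apply/measurable_EFinP; apply: continuous_measurable_fun.
  exact: exp_norm_continuous.
have mexp := continuous_measurable_fun exp_norm_continuous.
have E := integral_exp_cos 0.
apply: (@le_lt_trans _ _ (2 + poisson 0)%:E); last exact: ltry.
rewrite -E; apply: ge0_le_integral => //.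
- by apply: measurableT_comp => //; exact/measurable_EFinP.
- apply/measurable_EFinP/measurable_funM; first exact: mexp.
  by apply: measurable_funD => //; exact: measurable_cosM.
- move=> w _; rewrite mul0r cos0 /= lee_fin ger0_norm ?expR_ge0//.
  by rewrite ler_peMr ?expR_ge0// lerDl.
Qed.

(** Formula integral_exp_cos at 0 gives the integral of exp (- |w|), which is then
    subtracted. *)
Lemma fourier_exp_norm v :
  \int[leb R]_w (expR (- `|w|) * cos (v * w)) = poisson v.
Proof.
have ic u := integrable_mul_cos u integrable_exp_norm.
have E u : \int[leb R]_w expR (- `|w|) +
    \int[leb R]_w (expR (- `|w|) * cos (u * w)) = 2 + poisson u.
  rewrite -RintegralD//; last exact: integrable_exp_norm.
  rewrite /Rintegral -[RHS]/(fine (2 + poisson u)%:E) -integral_exp_cos.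
  by congr fine; apply: eq_integral => w _; rewrite mulrDr mulr1.
have solve (a b p : R) : a + b = 2 + p -> a + a = 2 + 2 -> b = p.
  move=> ab /eqP; rewrite -!mulr2n eqrMn2r//= => /eqP a2.
  by move: ab; rewrite a2 => /addrI.
apply: solve (E v) _; rewrite [X in _ + X](_ : _ =
  \int[leb R]_w (expR (- `|w|) * cos (0 * w))).
  by rewrite E /poisson expr0n/= addr0 divr1.
by apply: eq_Rintegral => w _; rewrite mul0r cos0 mulr1.
Qed.

Lemma poisson_gt0 v : 0 < poisson v.
Proof. by rewrite divr_gt0// ltr_pwDl// sqr_ge0. Qed.

Let poisson_continuous : continuous poisson.
Proof.
move=> v; apply: cvgM; first exact: cvg_cst.
exact: (@continuous_oneDsqrV R).
Qed.

Let integral_poisson_ereal : (\int[leb R]_v (poisson v)%:E = (2 * pi)%:E)%E.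
Proof.
rewrite ge0_symfun_integralT; last 3 first.
- by move=> v; rewrite ltW// poisson_gt0.
- exact: poisson_continuous.
- by move=> v; rewrite /poisson/= sqrrN.
rewrite -set_itvcy /poisson.
under eq_integral do rewrite EFinM.
rewrite ge0_integralZl//.
- by rewrite (integral0y_oneDsqr R) -!EFinM; congr EFin; field.
- have : measurable_fun setT (fun v : R => (1 + v ^+ 2)^-1).
    by apply: continuous_measurable_fun; exact: (@continuous_oneDsqrV R).
  by move=> /measurable_EFinP; exact: measurable_funTS.
- by move=> v _; rewrite lee_fin invr_ge0 addr_ge0 ?sqr_ge0.
Qed.

Lemma integrable_poisson : (leb R).-integrable setT (EFin \o poisson).
Proof.
apply/integrableP; split.
  apply/measurable_EFinP; apply: continuous_measurable_fun.
  exact: poisson_continuous.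
under eq_integral => v _ do rewrite gee0_abs ?lee_fin ?(ltW (poisson_gt0 _))//.
by rewrite integral_poisson_ereal ltry.
Qed.

Lemma integral_poisson : \int[leb R]_v poisson v = 2 * pi.
Proof. by rewrite /Rintegral integral_poisson_ereal. Qed.

End poisson_kernel.

(** * Fourier inversion by Abel summation *)

Section fourier_inversion.
Context (R : realType).

(** Fourier transform of the summability weight exp (- |w| / N). *)
Let scaled_exp_cos (N s : R) : 0 < N ->
  (leb R).-integrable setT (EFin \o (fun w => expR (- `|N^-1 * w|))) /\
  \int[leb R]_w (expR (- `|N^-1 * w|) * cos (s * w)) = N * poisson (N * s).
Proof.
move=> N0; have NV0 : 0 < N^-1 by rewrite invr_gt0.
have Ei : (leb R).-integrable setT (EFin \o (fun w => expR (- `|N^-1 * w|))).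
  have := integrable_affine 0 NV0 (integrable_exp_norm R).
  by apply: eq_integrable => // w _ /=; rewrite addr0.
split=> //.
rewrite (@Rintegral_affine R N 0 N0); last exact: integrable_mul_cos.
rewrite -fourier_exp_norm; congr (_ * _); apply: eq_Rintegral => w _.
rewrite addr0 (mulrA N^-1) mulVf ?gt_eqF// mul1r; congr (_ * cos _).
by rewrite mulrCA mulrA.
Qed.

(** Abel summation.  Inserting the weight exp (- |w| / N) in the left-hand side
    makes the double integral absolutely convergent; exchanging the integrals
    replaces the cosine by a rescaled Poisson kernel, and the substitution
    s = x / N leaves the integral of poisson x * h (x / N).  As N tends to +oo
    this tends to h 0 times the mass 2 pi of the kernel, because h is bounded
    and continuous at 0, while the weight tends to 1. *)
Lemma fourier_inversion (h : R -> R) (B : R) :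
  (leb R).-integrable setT (EFin \o h) -> (forall x, `|h x| <= B) ->
  {for 0, continuous h} ->
  (leb R).-integrable setT
    (EFin \o (fun w => \int[leb R]_s (h s * cos (w * s)))) ->
  \int[leb R]_w \int[leb R]_s (h s * cos (w * s)) = 2 * pi * h 0.
Proof.
move=> hi hB h0 ai; set a := (fun w => \int[leb R]_s _) in ai *.
have mh := integrable_measurable hi.
pose N (n : nat) : R := n.+1%:R.
have N0 n : 0 < N n by rewrite ltr0n.
pose J n := \int[leb R]_w (expR (- `|(N n)^-1 * w|) * a w).
have Nv (x : R) : (N n)^-1 * x @[n --> \oo] --> 0.
  by rewrite -(mul0r x); apply: cvgMl; exact: cvg_harmonic.
have cE n : continuous (fun w : R => expR (- `|(N n)^-1 * w|)).
  move=> w.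
  apply: (@continuous_comp _ _ _ (fun w : R => - `|(N n)^-1 * w|) (@expR R)).
    apply: cvgN; apply: cvg_norm; exact: mulrl_continuous.
  exact: continuous_expR.
have mE n := continuous_measurable_fun (cE n).
have J1 : J n @[n --> \oo] --> \int[leb R]_w a w.
  rewrite /J.
  apply: (real_dominated_convergence (mu := leb R) (g := fun w => `|a w|)
    (f_ := fun n w => expR (- `|(N n)^-1 * w|) * a w)) => [n|w||n w].
  - apply: measurable_funM; [exact: mE|exact: integrable_measurable ai].
  - rewrite -[X in _ --> X]mul1r -(@expR0 R) -(@oppr0 R) -(@normr0 _ R).
    apply: cvgMl; apply: (@continuous_cvg _ _ _ _ _ _ (@expR R)).
      exact: continuous_expR.
    by apply: cvgN; apply: cvg_norm; exact: Nv.
  - exact: integrable_norm.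
  - by rewrite normrM ger0_norm ?expR_ge0// ler_piMl// expR_le1 oppr_le0.
have J2 n : J n = \int[leb R]_x (poisson x * h ((N n)^-1 * x)).
  have [Ei _] := scaled_exp_cos 0 (N0 n).
  pose f (p : measurableTypeR R * measurableTypeR R) :=
    expR (- `|(N n)^-1 * p.1|) * (h p.2 * cos (p.1 * p.2)).
  have mf : measurable_fun setT f.
    apply: measurable_funM; first exact: (measurableT_comp (mE n) measurable_fst).
    apply: measurable_funM; first exact: (measurableT_comp mh measurable_snd).
    apply: (measurableT_comp (f := @cos R)).
      by apply: continuous_measurable_fun; exact: continuous_cos.
    exact: (measurable_funM measurable_fst measurable_snd).
  have fi : (leb R \x leb R)%E.-integrable setT (EFin \o f).
    apply: (integrable_prod_dominated mf Ei hi) => w s.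
    rewrite /f/= normrM [leRHS]normrM ler_wpM2l// normrM ler_piMr//.
    exact: cos_max.
  transitivity (\int[leb R]_w \int[leb R]_s f (w, s)).
    apply: eq_Rintegral => w _; rewrite /f/= RintegralZl//.
    exact: integrable_mul_cos.
  rewrite (real_fubini fi).
  have NV0 : 0 < (N n)^-1 by rewrite invr_gt0.
  have inner s : \int[leb R]_w f (w, s) = h s * (N n * poisson (N n * s)).
    have [_ <-] := scaled_exp_cos s (N0 n).
    rewrite -RintegralZl//; last exact: integrable_mul_cos.
    by apply: eq_Rintegral => w _; rewrite /f/= (mulrC w s); ring.
  rewrite [LHS](@Rintegral_affine R (N n)^-1 0 NV0); last exact: (real_fubini2 fi).
  rewrite -RintegralZl//; last first.
    exact: (integrable_affine 0 NV0 (real_fubini2 fi)).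
  apply: eq_Rintegral => x _; rewrite inner addr0.
  rewrite (mulrA (N n)) mulfV ?gt_eqF// mul1r.
  by rewrite mulrCA (mulrA (N n)^-1) mulVf ?gt_eqF// mul1r mulrC.
have J3 : J n @[n --> \oo] --> \int[leb R]_x (poisson x * h 0).
  under eq_fun do rewrite J2.
  apply: (real_dominated_convergence (mu := leb R)
    (g := fun x => B * poisson x)
    (f_ := fun n x => poisson x * h ((N n)^-1 * x))) => [n|x||n x].
  - apply: measurable_funM.
      exact: integrable_measurable (integrable_poisson R).
    apply: (measurableT_comp mh); apply: continuous_measurable_fun.
    exact: mulrl_continuous.
  - by apply: cvgMr; apply: continuous_cvg => //; exact: Nv.
  - exact: integrable_mulrl (integrable_poisson R).
  - rewrite normrM (ger0_norm (ltW (poisson_gt0 x))) mulrC.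
    by rewrite ler_wpM2r ?(ltW (poisson_gt0 x)).
rewrite -(cvg_lim (@Rhausdorff R) J1) (cvg_lim (@Rhausdorff R) J3).
by rewrite RintegralZr ?integral_poisson//; exact: integrable_poisson.
Qed.

End fourier_inversion.

(** * Correlations of square-integrable functions *)

Section translation.
Context (R : realType).
Implicit Types (f g : R -> R) (s : R).

Lemma integrable_translate f s : (leb R).-integrable setT (EFin \o f) ->
  (leb R).-integrable setT (EFin \o (fun x => f (x + s))).
Proof.
move=> fi; have := integrable_affine s ltr01 fi.
by apply: eq_integrable => // x _ /=; rewrite mul1r.
Qed.

Lemma Rintegral_translate f s : (leb R).-integrable setT (EFin \o f) ->
  \int[leb R]_x f (x + s) = \int[leb R]_x f x.
Proof.
move=> fi; rewrite [RHS](Rintegral_affine s ltr01 fi) mul1r.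
by apply: eq_Rintegral => x _; rewrite mul1r.
Qed.

Lemma measurable_translate f s : measurable_fun setT f ->
  measurable_fun setT (fun x : R => f (x + s)).
Proof.
move=> mf; apply: (measurableT_comp mf); apply: continuous_measurable_fun => x.
by apply: cvgD; [exact: cvg_id|exact: cvg_cst].
Qed.

Lemma Lfun2_translate f s : f \in Lfun (leb R) 2%:E ->
  (fun x => f (x + s)) \in Lfun (leb R) 2%:E.
Proof.
move=> /Lfun2P[mf fi]; apply/Lfun2P; split.
  exact: measurable_translate.
exact: (integrable_translate s fi).
Qed.

Lemma sqnorm_translate f s : f \in Lfun (leb R) 2%:E ->
  sqnorm (leb R) (fun x => f (x + s)) = sqnorm (leb R) f.
Proof. by move=> /Lfun2P[_ fi]; exact: (Rintegral_translate s fi). Qed.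

End translation.

(** This is the integral of f x * g (x - s); shifting the first factor avoids
    reflections in changes of variable. *)
Definition corr (R : realType) (f g : R -> R) (s : R) : R :=
  \int[leb R]_y (f (y + s) * g y).

Section correlation.
Context (R : realType).
Implicit Types (f g : R -> R) (s : R).

Lemma integrable_corr f g s : f \in Lfun (leb R) 2%:E ->
  g \in Lfun (leb R) 2%:E ->
  (leb R).-integrable setT (EFin \o (fun y => f (y + s) * g y)).
Proof. by move=> f2 g2; apply: Lfun2_mul => //; exact: Lfun2_translate. Qed.

Lemma corr_bound f g s : f \in Lfun (leb R) 2%:E -> g \in Lfun (leb R) 2%:E ->
  `|corr f g s| <= Num.sqrt (sqnorm (leb R) f) * Num.sqrt (sqnorm (leb R) g).
Proof.
move=> f2 g2; have := cauchy_schwarz (Lfun2_translate s f2) g2.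
by rewrite sqnorm_translate.
Qed.

Lemma continuous_at_uniform_approx (H : R -> R) (s : R) :
  (forall e : R, 0 < e -> exists2 h : R -> R, {for s, continuous h} &
    forall x, `|H x - h x| <= e) -> {for s, continuous H}.
Proof.
move=> happ; apply/cvgrPdist_le => /= e e0.
have [h hs Hh] := happ (e / 3) (divr_gt0 e0 (ltr0n _ 3)).
have e30 : 0 < e / 3 by rewrite divr_gt0.
near=> x.
have -> : H s - H x = (H s - h s) + (h s - h x) + (h x - H x) by ring.
rewrite (le_trans (ler_normD _ _))//.
have -> : e = e / 3 + e / 3 + e / 3 by field.
rewrite lerD//; last by rewrite distrC.
rewrite (le_trans (ler_normD _ _))// lerD//.
by near: x; move/cvgrPdist_le : hs; exact.
Unshelve. all: by end_near. Qed.

(** Cutting a continuous function off to an interval creates only two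
    discontinuities, which dominated convergence ignores. *)
Lemma continuous_corr_cutoff (phi g : R -> R) (A s : R) :
  continuous phi -> (leb R).-integrable setT (EFin \o g) ->
  {for s, continuous (corr (fun x => phi x * \1_(`[- A, A]) x) g)}.
Proof.
move=> cphi gi; pose f := fun x : R => phi x * \1_(`[- A, A]) x.
rewrite -/f.
have [C Cphi] : exists C, forall x, `|f x| <= C.
  have /(continuous_compact (continuous_subspaceT cphi))/compact_bounded :=
    @segment_compact R (- A) A.
  move=> [C [_ /(_ (`|C| + 1))]]; rewrite (le_lt_trans (ler_norm _)) ?ltrDl//.
  move=> /(_ isT) bC; exists (`|C| + 1) => x.
  rewrite /f indicE; have [xA|xA] := boolP (x \in _); last first.
    by rewrite mulr0 normr0 addr_ge0.
  by rewrite mulr1; apply: bC; exists x => //; rewrite inE in xA.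
have mg := integrable_measurable gi.
have mf : measurable_fun setT f.
  apply: measurable_funM; first exact: continuous_measurable_fun.
  exact: measurable_indic.
have cf z : z != A -> z != - A -> {for z, continuous f}.
  move=> zA zNA; have [zi|zo] := boolP (z \in `]- A, A[).
    have : {near z, phi =1 f}.
      near=> x; rewrite /f indicE mem_set ?mulr1//=.
      by apply: subset_itv_oo_cc; near: x; exact: near_in_itvoo.
    move=> eqf; apply: cvg_trans (near_eq_cvg eqf) _.
    by rewrite -(nbhs_singleton eqf); exact: cphi.
  have zlt : A < `|z| .
    rewrite lt_neqAle; apply/andP; split.
      apply/eqP => Az; case: (ger0P z) Az => _ Az; first by rewrite -Az eqxx in zA.
      by rewrite Az opprK eqxx in zNA.
    rewrite leNgt; apply: contra zo => zA'; rewrite in_itv/=.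
    by rewrite -ltr_norml.
  have : {near z, cst 0 =1 f}.
    near=> x; rewrite /f indicE memNset ?mulr0//= in_itv/= -ler_norml.
    apply/negP; rewrite -ltNge; near: x.
    by apply: (cvgr_norm_gt (f := id) z); [exact: cvg_id|exact: zlt].
  move=> eqf; apply: cvg_trans (near_eq_cvg eqf) _.
  by rewrite -(nbhs_singleton eqf); exact: cvg_cst.
apply/(@cvg_nbhsP _ R^o) => u us.
apply: (ae_real_dominated_convergence (mu := leb R) (g := fun y => C * `|g y|)
  (f_ := fun n y => f (y + u n) * g y)).
- by move=> n; apply: measurable_funM => //; exact: measurable_translate.
- by apply: measurable_funM => //; exact: measurable_translate.
- have /negligibleS : (leb R).-negligible ([set A - s] `|` [set - A - s]).
    by apply: negligibleU; apply/negligibleP => //; exact: lebesgue_measure_set1.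
  apply=> y /= ny; apply: contrapT => /not_orP[y1 y2]; apply: ny.
  apply: cvgMl; apply: (@continuous_cvg _ _ _ _ _ _ f).
    apply: cf; apply/eqP => E.
      by apply: y1; rewrite -E addrK.
    by apply: y2; rewrite -E addrK.
  by apply: cvgD => //; exact: cvg_cst.
- exact: integrable_mulrl (integrable_norm gi).
- by move=> n y; rewrite normrM ler_wpM2r.
Unshelve. all: by end_near. Qed.

End correlation.

(** * Continuity of correlations *)

Section correlation_continuity.
Context (R : realType).
Implicit Types (f g : R -> R) (s : R).

Definition cutoff (A : R) f : R -> R := fun x => f x * \1_(`[- A, A]) x.

Lemma norm_cutoff_le A f x : `|cutoff A f x| <= `|f x|.
Proof.
by rewrite /cutoff indicE; case: (_ \in _); rewrite ?mulr1// mulr0 normr0.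
Qed.

Lemma measurable_cutoff A f : measurable_fun setT f ->
  measurable_fun setT (cutoff A f).
Proof. by move=> mf; apply: measurable_funM => //; exact: measurable_indic. Qed.

Lemma Lfun2_cutoff A f : f \in Lfun (leb R) 2%:E ->
  cutoff A f \in Lfun (leb R) 2%:E.
Proof.
move=> f2; apply: (Lfun2_le f2); last exact: norm_cutoff_le.
by apply: measurable_cutoff; have [] := (Lfun2P (leb R) f).1 f2.
Qed.

Lemma Lfun2_indic_itv A : (\1_(`[- A, A]) : R -> R) \in Lfun (leb R) 2%:E.
Proof.
apply/Lfun2P; split; first exact: measurable_indic.
have := integrable_indic_itv (- A) A true false.
apply: eq_integrable => // x _ /=.
by rewrite indicE; case: (_ \in _); rewrite ?expr1n ?expr0n.
Qed.

Lemma integrable_cutoff A f : f \in Lfun (leb R) 2%:E ->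
  (leb R).-integrable setT (EFin \o cutoff A f).
Proof. by move=> f2; exact: (Lfun2_mul (mu := leb R) f2 (Lfun2_indic_itv A)). Qed.

(** The approximation keeps the values of modulus at most B and replaces the
    others by 0. *)
Lemma bounded_approx_sqnorm g (e : R) : g \in Lfun (leb R) 2%:E -> 0 < e ->
  exists (B : R) (g' : R -> R), [/\ measurable_fun setT g',
    forall x, `|g' x| <= B, forall x, `|g' x| <= `|g x|,
    (fun x => g x - g' x) \in Lfun (leb R) 2%:E &
    sqnorm (leb R) (fun x => g x - g' x) <= e].
Proof.
move=> g2 e0; have [mg gi] := (Lfun2P (leb R) g).1 g2.
pose S (n : nat) : set R := [set x | `|g x| <= n%:R].
pose g_ n x := g x * \1_(S n) x.
have mS n : measurable (S n).
  rewrite (_ : S n = (fun x => `|g x|) @^-1` `]-oo, n%:R]); last first.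
    by apply/seteqP; split=> x /=; rewrite in_itv.
  by rewrite -[X in measurable X]setTI; apply: measurableT_comp.
have mg_ n : measurable_fun setT (g_ n).
  by apply: measurable_funM => //; exact: measurable_indic.
have dle n x : `|g x - g_ n x| <= `|g x|.
  rewrite /g_ indicE; case: (_ \in _); first by rewrite mulr1 subrr normr0.
  by rewrite mulr0 subr0.
have d2 n : (fun x => g x - g_ n x) \in Lfun (leb R) 2%:E.
  by apply: (Lfun2_le g2) => //; exact: (measurable_funB mg (mg_ n)).
have cv : sqnorm (leb R) (fun x => g x - g_ n x) @[n --> \oo] --> 0.
  rewrite -[X in _ --> X](_ : \int[leb R]_x 0 = _); last first.
    by rewrite /Rintegral integral0.
  apply: (real_dominated_convergence (mu := leb R) (g := fun x => g x ^+ 2)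
    (f_ := fun n x => (g x - g_ n x) ^+ 2)) => //.
  - by move=> n; apply: measurable_funX; exact: (measurable_funB mg (mg_ n)).
  - move=> x; apply: cvg_near_cst; near=> n.
    rewrite /g_ indicE mem_set ?mulr1 ?subrr ?expr0n//= /S/=.
    by near: n; exact: nbhs_infty_ger.
  - move=> n x; rewrite normrX -[leRHS]real_normK ?num_real//.
    by rewrite ler_pXn2r// nnegrE.
have [n _ /(_ n (leqnn n)) /= nle] : \forall n \near \oo,
    sqnorm (leb R) (fun x => g x - g_ n x) <= e.
  move/cvgrPdist_le : cv => /(_ e e0); apply: filterS => n.
  by rewrite sub0r normrN ger0_norm ?sqnorm_ge0.
exists n%:R, (g_ n); split => // x; rewrite /g_ indicE.
- have [|_] := boolP (x \in S n); last by rewrite mulr0 normr0.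
  by rewrite inE mulr1.
- by case: (_ \in _); rewrite ?mulr1// mulr0 normr0.
Unshelve. all: by end_near. Qed.

(** A correlation is uniformly small when one factor is small in L2 and the
    other bounded in L2, or when one factor is small in L1 and the other bounded.
    So g can be replaced by a bounded function, and then f by a function
    continuous on the interval of cut-off, without moving the correlation by
    more than e. *)
Lemma continuous_corr f g (A s : R) : f \in Lfun (leb R) 2%:E ->
  g \in Lfun (leb R) 2%:E -> (leb R).-integrable setT (EFin \o g) ->
  {for s, continuous (corr (cutoff A f) g)}.
Proof.
move=> f2 g2 gi; have mf : measurable_fun setT f by have [] := (Lfun2P (leb R) f).1 f2.
have F2 := Lfun2_cutoff A f2; have Fi := integrable_cutoff A f2.
set F := cutoff A f in F2 Fi *.
apply: continuous_at_uniform_approx => e e0.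
pose c := Num.sqrt (sqnorm (leb R) F).
have c0 : 0 <= c by exact: sqrtr_ge0.
have ec0 : 0 < e / 2 / (c + 1) by rewrite !divr_gt0// ltr_pwDr.
have [B [g' [mg' g'B g'g d2 dle]]] := bounded_approx_sqnorm g2 (exprn_gt0 2 ec0).
have g'2 : g' \in Lfun (leb R) 2%:E by exact: (Lfun2_le g2).
have g'i : (leb R).-integrable setT (EFin \o g').
  apply: le_integrable gi => //; first exact/measurable_EFinP.
  by move=> x _; rewrite lee_fin.
have B0 : 0 <= B by rewrite (le_trans _ (g'B 0)).
have eB0 : 0 < e / 2 / (B + 1) by rewrite !divr_gt0// ltr_pwDr.
pose E : set R := `[- A, A]%classic.
have Eoo : (leb R E < +oo)%E.
  rewrite /E lebesgue_measure_itv/=; case: ifP => _; last by rewrite ltry.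
  by rewrite -EFinB ltry.
have fE : (leb R).-integrable E (EFin \o f).
  apply/(integrable_mkcond _ _); first exact: measurable_itv.
  apply: eq_integrable Fi => // x _.
  rewrite /F /cutoff /= patchE indicE.
  by case: ifPn => xE; rewrite ?xE ?(negbTE xE) ?mulr1 ?mulr0.
have [phi [cphi phii phile]] : exists phi : R -> R, [/\ continuous phi,
    (leb R).-integrable setT (EFin \o cutoff A phi) &
    \int[leb R]_x `|F x - cutoff A phi x| <= e / 2 / (B + 1)].
  have [p_ [cp ip cvp]] :=
    approximation_continuous_integrable (measurable_itv _) Eoo fE.
  have [n _ /(_ n (leqnn n)) /= nle] : \forall n \near \oo,
      \int[leb R]_(x in E) `|f x - p_ n x| <= e / 2 / (B + 1).
    move/fine_cvg/cvgrPdist_le : cvp => /(_ _ eB0); apply: filterS => n.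
    by rewrite /= sub0r normrN; apply: le_trans; exact: ler_norm.
  exists (p_ n); split; first exact: cp.
    have /(integrable_mkcond _ _) := ip n.
    move=> /(_ (measurable_itv _)); apply: eq_integrable => // x _.
    by rewrite /cutoff /= patchE indicE; case: ifPn; rewrite ?mulr1 ?mulr0.
  apply: le_trans nle; rewrite [leRHS]Rintegral_mkcond le_eqVlt; apply/orP; left.
  apply/eqP; apply: eq_Rintegral => x _.
  rewrite /F /cutoff patchE indicE -/E; case: ifPn => _; rewrite ?mulr1//.
  by rewrite !mulr0 subrr normr0.
set G := cutoff A phi in phii phile *.
exists (corr G g'); first exact: continuous_corr_cutoff.
move=> x.
have Fx := integrable_translate x Fi; have Gx := integrable_translate x phii.
have FGx := integrable_subr Fx Gx.
have FGg := integrable_bounded_mul FGx mg' g'B.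
have -> : corr F g x - corr G g' x = corr F (fun y => g y - g' y) x +
    \int[leb R]_y ((F (y + x) - G (y + x)) * g' y).
  rewrite /corr -RintegralB//; last 2 first.
    exact: integrable_corr.
    exact: (integrable_bounded_mul Gx mg' g'B).
  rewrite -RintegralD//; last exact: integrable_corr.
  by apply: eq_Rintegral => y _; ring.
rewrite (le_trans (ler_normD _ _))// (_ : e = e / 2 + e / 2); last by field.
have shrink (b u v : R) : 0 <= b -> 0 < v -> u <= v / (b + 1) -> b * u <= v.
  move=> b0 v0 uv; rewrite (le_trans (ler_wpM2l b0 uv))//.
  by rewrite mulrCA ger_pMr// ler_pdivrMr ?mul1r ?lerDl ?ltr_pwDr.
rewrite lerD//.
  rewrite (le_trans (corr_bound _ F2 d2))// -/c; apply: shrink => //.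
    by rewrite divr_gt0.
  rewrite -(ger0_norm (ltW ec0)) -sqrtr_sqr.
  by apply: ler_wsqrtr.
have B1 : `|\int[leb R]_y ((F (y + x) - G (y + x)) * g' y)| <=
    B * \int[leb R]_y `|F y - G y|.
  rewrite (le_trans (le_normr_Rintegral _ FGg))//.
  rewrite -(Rintegral_translate x (integrable_norm (integrable_subr Fi phii))).
  rewrite -RintegralZl//; last exact: (integrable_norm FGx).
  apply: le_Rintegral => //; first exact: (integrable_norm FGg).
    exact: integrable_mulrl (integrable_norm FGx).
  by move=> y _; rewrite normrM mulrC ler_wpM2r.
by rewrite (le_trans B1)//; apply: shrink => //; rewrite divr_gt0.
Qed.

End correlation_continuity.

(** * Plancherel's formula for functions of bounded support *)

Section parseval_compact.
Context (R : realType).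
Implicit Types (f g : R -> R) (w s tau : R).

Definition cos_transform f w : R := \int[leb R]_t (f t * cos (w * t)).
Definition sin_transform f w : R := \int[leb R]_t (f t * sin (w * t)).

(** The real part of a * conj b * exp (i * theta), for the complex numbers
    a = a1 + i * a2 and b = b1 + i * b2. *)
Definition cross_spectrum (a1 a2 b1 b2 theta : R) : R :=
  (a1 * b1 + a2 * b2) * cos theta + (a1 * b2 - a2 * b1) * sin theta.

Lemma integrable_cross_spectrum (a1 a2 b1 b2 : R -> R) tau :
  a1 \in Lfun (leb R) 2%:E -> a2 \in Lfun (leb R) 2%:E ->
  b1 \in Lfun (leb R) 2%:E -> b2 \in Lfun (leb R) 2%:E ->
  (leb R).-integrable setT (EFin \o
    (fun w => cross_spectrum (a1 w) (a2 w) (b1 w) (b2 w) (tau * w))).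
Proof.
move=> a12 a22 b12 b22; apply: integrable_addr.
  apply: integrable_mul_cos; apply: integrable_addr; exact: Lfun2_mul.
apply: integrable_mul_sin; apply: integrable_subr; exact: Lfun2_mul.
Qed.

(** Young's inequality for the exponents (1, 1): the integrand of a correlation
    is integrable jointly in the lag and the position. *)
Lemma integrable_corr_prod f g : (leb R).-integrable setT (EFin \o f) ->
  (leb R).-integrable setT (EFin \o g) ->
  (leb R \x leb R)%E.-integrable setT
    (EFin \o (fun p : measurableTypeR R * measurableTypeR R =>
      f (p.2 + p.1) * g p.2)).
Proof.
move=> fi gi.
have mf := integrable_measurable fi; have mg := integrable_measurable gi.
apply/integrable21ltyP.
  apply/measurable_EFinP; apply: measurable_funM.
    apply: (measurableT_comp mf).
    exact: (measurable_funD measurable_snd measurable_fst).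
  exact: (measurableT_comp mg measurable_snd).
move/integrableP : (fi) => [mEf fy]; move/integrableP : (gi) => [mEg gy].
rewrite (_ : (\int[leb R]_y _)%E = ((\int[leb R]_s `|(f s)%:E|) *
    (\int[leb R]_y `|(g y)%:E|))%E).
  by rewrite lte_mul_pinfty ?ge0_fin_numE//; exact: integral_ge0.
rewrite -ge0_integralZl//; last 2 first.
- exact: measurableT_comp.
- exact: integral_ge0.
have mabs : measurable_fun setT (fun x => `|(f x)%:E|)%E.
  exact: measurableT_comp.
apply: eq_integral => y _ /=.
rewrite (ge0_integral_affine y ltr01 mabs (fun=> abse_ge0 _)) mul1e muleC.
rewrite -ge0_integralZl//.
  by apply: eq_integral => s _; rewrite /= mul1r addrC normrM mulrC EFinM.
apply: measurableT_comp => //; apply/measurable_EFinP.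
apply: (measurableT_comp mf); apply: continuous_measurable_fun => s.
by apply: cvgD; [exact: mulrl_continuous|exact: cvg_cst].
Qed.

(** After the substitution s = x - y - tau, the addition formula splits
    cos (w * (x - y - tau)) into products of functions of x and of y, which
    Fubini's theorem integrates separately. *)
Lemma cos_transform_corr f g tau w :
  f \in Lfun (leb R) 2%:E -> g \in Lfun (leb R) 2%:E ->
  (leb R).-integrable setT (EFin \o f) ->
  (leb R).-integrable setT (EFin \o g) ->
  \int[leb R]_s (corr f g (s + tau) * cos (w * s)) =
  cross_spectrum (cos_transform f w) (- sin_transform f w)
    (cos_transform g w) (- sin_transform g w) (tau * w).
Proof.
move=> f2 g2 fi gi.
have fti := integrable_translate tau fi.
have fgi := integrable_corr_prod fti gi.
pose k (p : measurableTypeR R * measurableTypeR R) :=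
  f (p.2 + p.1 + tau) * g p.2 * cos (w * p.1).
have ki : (leb R \x leb R)%E.-integrable setT (EFin \o k).
  apply: (integrable_bounded_mul fgi (B := 1)); last by move=> p; exact: cos_max.
  exact: (measurableT_comp (measurable_cosM w) measurable_fst).
transitivity (\int[leb R]_s \int[leb R]_y k (s, y)).
  apply: eq_Rintegral => s _; rewrite /k/= /corr.
  rewrite -RintegralZr//; last exact: integrable_corr.
  by apply: eq_Rintegral => y _; rewrite addrA.
rewrite (real_fubini ki).
have ic := integrable_mul_cos w fi; have isn := integrable_mul_sin w fi.
have inner y : \int[leb R]_s k (s, y) =
    g y * (cos_transform f w * cos (w * (y + tau)) +
           sin_transform f w * sin (w * (y + tau))).
  pose r x := g y * (f x * cos (w * x) * cos (w * (y + tau)) +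
                     f x * sin (w * x) * sin (w * (y + tau))).
  have icy := integrable_mulrl (cos (w * (y + tau))) ic.
  have isy := integrable_mulrl (sin (w * (y + tau))) isn.
  have rE x : r x = g y * (cos (w * (y + tau)) * (f x * cos (w * x)) +
                     sin (w * (y + tau)) * (f x * sin (w * x))).
    by rewrite /r; ring.
  have ri : (leb R).-integrable setT (EFin \o r).
    have := integrable_mulrl (g y) (integrable_addr icy isy).
    by apply: eq_integrable => // x _ /=; rewrite rE.
  transitivity (\int[leb R]_x r x).
    rewrite -(Rintegral_translate (y + tau) ri); apply: eq_Rintegral => s _.
    rewrite /k /r/= (_ : y + s + tau = s + (y + tau)); last by ring.
    rewrite (_ : w * s = w * (s + (y + tau)) - w * (y + tau)); last by ring.
    by rewrite cosB; ring.
  under eq_Rintegral do rewrite rE.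
  rewrite RintegralZl//; last exact: (integrable_addr icy isy).
  rewrite RintegralD// !RintegralZl//.
  by rewrite /cos_transform /sin_transform; ring.
under eq_Rintegral do rewrite inner.
pose a := cos_transform f w * cos (tau * w) + sin_transform f w * sin (tau * w).
pose b := sin_transform f w * cos (tau * w) - cos_transform f w * sin (tau * w).
have jc := integrable_mul_cos w gi; have js := integrable_mul_sin w gi.
transitivity (\int[leb R]_y (a * (g y * cos (w * y)) + b * (g y * sin (w * y)))).
  apply: eq_Rintegral => y _; rewrite (mulrDr w) cosD sinD (mulrC w tau) /a /b.
  by ring.
rewrite RintegralD//; [|exact: integrable_mulrl|exact: integrable_mulrl].
rewrite !RintegralZl// -/(cos_transform g w) -/(sin_transform g w).
by rewrite /cross_spectrum /a /b; ring.
Qed.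

(** Plancherel's formula for a correlation, on functions cut off to a bounded
    interval.  The square integrability of the transforms is a hypothesis here;
    it makes their cross spectrum integrable, so that Fourier inversion
    applies. *)
Lemma parseval_cutoff f g (A tau : R) :
  f \in Lfun (leb R) 2%:E -> g \in Lfun (leb R) 2%:E ->
  cos_transform (cutoff A f) \in Lfun (leb R) 2%:E ->
  sin_transform (cutoff A f) \in Lfun (leb R) 2%:E ->
  cos_transform (cutoff A g) \in Lfun (leb R) 2%:E ->
  sin_transform (cutoff A g) \in Lfun (leb R) 2%:E ->
  \int[leb R]_w cross_spectrum
    (cos_transform (cutoff A f) w) (- sin_transform (cutoff A f) w)
    (cos_transform (cutoff A g) w) (- sin_transform (cutoff A g) w)
    (tau * w) = 2 * pi * corr (cutoff A f) (cutoff A g) tau.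
Proof.
move=> f2 g2 cf2 sf2 cg2 sg2.
have F2 := Lfun2_cutoff A f2; have G2 := Lfun2_cutoff A g2.
have Fi := integrable_cutoff A f2; have Gi := integrable_cutoff A g2.
set F := cutoff A f in F2 Fi cf2 sf2 *; set G := cutoff A g in G2 Gi cg2 sg2 *.
pose h s := corr F G (s + tau).
have hi : (leb R).-integrable setT (EFin \o h).
  have := (real_fubini1 (integrable_corr_prod (integrable_translate tau Fi) Gi)).1.
  apply: eq_integrable => // s _ /=; congr EFin; apply: eq_Rintegral => y _.
  by rewrite addrA.
have aE w : \int[leb R]_s (h s * cos (w * s)) = cross_spectrum
    (cos_transform F w) (- sin_transform F w)
    (cos_transform G w) (- sin_transform G w) (tau * w).
  exact: cos_transform_corr.
have N2 u : u \in Lfun (leb R) 2%:E -> (fun w => - u w) \in Lfun (leb R) 2%:E.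
  move=> u2; apply: (Lfun2_le u2) => [|x]; last by rewrite normrN.
  by apply: measurableT_comp => //; have [] := (Lfun2P (leb R) u).1 u2.
have ai : (leb R).-integrable setT
    (EFin \o (fun w => \int[leb R]_s (h s * cos (w * s)))).
  have := integrable_cross_spectrum tau cf2 (N2 _ sf2) cg2 (N2 _ sg2).
  by apply: eq_integrable => // w _ /=; rewrite aE.
under eq_Rintegral do rewrite -aE.
rewrite (fourier_inversion hi (fun s => corr_bound (s + tau) F2 G2) _ ai).
  by rewrite /h add0r.
apply: (@continuous_comp _ _ _ (fun s => s + tau) (corr F G)).
  by apply: cvgD; [exact: cvg_id|exact: cvg_cst].
by rewrite add0r; exact: continuous_corr.
Qed.

End parseval_compact.

(** * Convergence in L2 *)

Section plancherel.
Context (R : realType).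
Implicit Types (f g u v b : R -> R) (w s tau : R).

(** The first conjunct excludes the indices at which the difference is not square
    integrable, for which sqnorm is a junk value. *)
Definition L2cvg (u_ : (R -> R)^nat) u : Prop :=
  (\forall n \near \oo, (fun w => u_ n w - u w) \in Lfun (leb R) 2%:E) /\
  sqnorm (leb R) (fun w => u_ n w - u w) @[n --> \oo] --> 0.

Lemma Lfun2_add u v : u \in Lfun (leb R) 2%:E -> v \in Lfun (leb R) 2%:E ->
  (fun w => u w + v w) \in Lfun (leb R) 2%:E.
Proof.
move=> u2 v2; have [mu ui] := (Lfun2P (leb R) u).1 u2.
have [mv vi] := (Lfun2P (leb R) v).1 v2.
apply/Lfun2P; split; first exact: measurable_funD.
have := integrable_addr (integrable_addr ui vi)
  (integrable_mulrl 2 (Lfun2_mul u2 v2)).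
by apply: eq_integrable => // w _ /=; congr EFin; ring.
Qed.

Lemma Lfun2_bounded_mul u b : u \in Lfun (leb R) 2%:E ->
  measurable_fun setT b -> (forall w, `|b w| <= 1) ->
  (fun w => u w * b w) \in Lfun (leb R) 2%:E.
Proof.
move=> u2 mb b1; apply: (Lfun2_le u2).
  by apply: measurable_funM => //; have [] := (Lfun2P (leb R) u).1 u2.
by move=> w; rewrite normrM ler_piMr.
Qed.

(** Expand u_n v_n - u v in the differences u_n - u and v_n - v, and apply the
    Cauchy-Schwarz inequality to each term. *)
Lemma L2cvg_pairing (u_ v_ : (R -> R)^nat) u v b :
  u \in Lfun (leb R) 2%:E -> v \in Lfun (leb R) 2%:E ->
  L2cvg u_ u -> L2cvg v_ v ->
  measurable_fun setT b -> (forall w, `|b w| <= 1) ->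
  \int[leb R]_w (u_ n w * v_ n w * b w) @[n --> \oo] -->
  \int[leb R]_w (u w * v w * b w).
Proof.
move=> u2 v2 [du2 du0] [dv2 dv0] mb b1.
pose du n w := u_ n w - u w; pose dv n w := v_ n w - v w.
pose N x := Num.sqrt (sqnorm (leb R) x).
have CS x y : x \in Lfun (leb R) 2%:E -> y \in Lfun (leb R) 2%:E ->
    (leb R).-integrable setT (EFin \o (fun w => x w * y w * b w)) /\
    `|\int[leb R]_w (x w * y w * b w)| <= N x * N y.
  move=> x2 y2; have yb2 := Lfun2_bounded_mul y2 mb b1.
  have xyb := Lfun2_mul x2 yb2; split.
    by apply: eq_integrable xyb => // w _ /=; rewrite mulrA.
  under eq_Rintegral do rewrite -mulrA.
  apply: (le_trans (cauchy_schwarz x2 yb2)).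
  rewrite ler_wpM2l ?sqrtr_ge0// ler_wsqrtr// le_Rintegral//.
    by have [] := (Lfun2P (leb R) _).1 yb2.
    by have [] := (Lfun2P (leb R) _).1 y2.
  move=> w _; rewrite exprMn ler_piMr ?sqr_ge0//.
  by rewrite -real_normK ?num_real// expr_le1.
have N0 (x_ : (R -> R)^nat) : sqnorm (leb R) (x_ n) @[n --> \oo] --> 0 ->
    N (x_ n) @[n --> \oo] --> 0.
  move=> x0; rewrite -(@sqrtr0 R).
  by apply: (@continuous_cvg _ _ _ _ _ _ (@Num.sqrt R)) => //; exact: sqrt_continuous.
have Ndu := N0 _ du0; have Ndv := N0 _ dv0.
have bound : \forall n \near \oo,
    `|\int[leb R]_w (u w * v w * b w) - \int[leb R]_w (u_ n w * v_ n w * b w)| <=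
    N (du n) * N (dv n) + N (du n) * N v + N u * N (dv n).
  near=> n.
  have dun : du n \in Lfun (leb R) 2%:E by near: n.
  have dvn : dv n \in Lfun (leb R) 2%:E by near: n.
  have [i1 b1'] := CS _ _ dun dvn; have [i2 b2] := CS _ _ dun v2.
  have [i3 b3] := CS _ _ u2 dvn; have [i4 _] := CS _ _ u2 v2.
  have i12 := integrable_addr i1 i2; have i123 := integrable_addr i12 i3.
  have -> : \int[leb R]_w (u_ n w * v_ n w * b w) =
      \int[leb R]_w (du n w * dv n w * b w) + \int[leb R]_w (du n w * v w * b w) +
      \int[leb R]_w (u w * dv n w * b w) + \int[leb R]_w (u w * v w * b w).
    rewrite -!RintegralD//; apply: eq_Rintegral => w _; rewrite /du /dv; ring.
  rewrite opprD addrCA subrr addr0 normrN.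
  rewrite (le_trans (ler_normD _ _))// lerD// (le_trans (ler_normD _ _))//.
  by rewrite lerD.
apply/cvgrPdist_le => e e0.
have lim0 : N (du n) * N (dv n) + N (du n) * N v + N u * N (dv n)
    @[n --> \oo] --> 0.
  rewrite -[X in _ --> X](_ : 0 * 0 + 0 * N v + N u * 0 = _); last by ring.
  apply: cvgD; last by apply: cvgMr.
  by apply: cvgD; [exact: cvgM|exact: cvgMl].
move/cvgrPdist_le : lim0 => /(_ e e0) lim0.
near=> n; rewrite (le_trans (near bound n _))//.
have : `|0 - (N (du n) * N (dv n) + N (du n) * N v + N u * N (dv n))| <= e.
  by near: n.
by rewrite sub0r normrN; apply: le_trans; exact: ler_norm.
Unshelve. all: by end_near. Qed.

End plancherel.

(** * Plancherel's formula for correlations *)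

Section fourier_transform.
Context (R : realType).
Implicit Types (f g : R -> R) (F G : R -> R[i]).

Lemma truncated_fourierE f (A w : R) : f \in Lfun (leb R) 2%:E ->
  truncated_fourier f A w =
  (cos_transform (cutoff A f) w +i* (- sin_transform (cutoff A f) w))%C.
Proof.
move=> f2; rewrite /truncated_fourier /cintegral /expi; congr Complex.
  rewrite Rintegral_mkcond; apply: eq_Rintegral => t _.
  rewrite /cutoff patchE indicE; case: ifPn => _; rewrite ?mulr1 ?mulr0 ?mul0r//=.
  by rewrite cosN mul0r subr0.
rewrite Rintegral_mkcond /sin_transform -[RHS]mulN1r -RintegralZl//; last first.
  exact: integrable_mul_sin (integrable_cutoff A f2).
apply: eq_Rintegral => t _.
rewrite /cutoff patchE indicE; case: ifPn => _; rewrite ?mulr1 ?mulr0 ?mul0r ?mulr0//=.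
by rewrite sinN mul0r addr0 mulrN mulN1r.
Qed.

Lemma measurable_cos_transform f : measurable_fun setT f ->
  measurable_fun setT (cos_transform f).
Proof.
move=> mf; pose k (p : measurableTypeR R * measurableTypeR R) :=
  f p.2 * cos (p.1 * p.2).
apply: (measurable_Rintegral1 (leb R) (f := k)); apply: measurable_funM.
  exact: (measurableT_comp mf measurable_snd).
apply: (measurableT_comp (f := @cos R)).
  by apply: continuous_measurable_fun; exact: continuous_cos.
exact: (measurable_funM measurable_fst measurable_snd).
Qed.

Lemma measurable_sin_transform f : measurable_fun setT f ->
  measurable_fun setT (sin_transform f).
Proof.
move=> mf; pose k (p : measurableTypeR R * measurableTypeR R) :=
  f p.2 * sin (p.1 * p.2).
apply: (measurable_Rintegral1 (leb R) (f := k)); apply: measurable_funM.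
  exact: (measurableT_comp mf measurable_snd).
apply: (measurableT_comp (f := @sin R)).
  by apply: continuous_measurable_fun; exact: continuous_sin.
exact: (measurable_funM measurable_fst measurable_snd).
Qed.

Lemma L2cvg_of_sum_squares (a_ b_ : (R -> R)^nat) (a b : R -> R) :
  (forall n, measurable_fun setT (a_ n)) ->
  (forall n, measurable_fun setT (b_ n)) ->
  measurable_fun setT a -> measurable_fun setT b ->
  (\int[leb R]_w ((a_ n w - a w) ^+ 2 + (b_ n w - b w) ^+ 2)%:E)%E
    @[n --> \oo] --> 0%E ->
  L2cvg a_ a /\ L2cvg b_ b.
Proof.
move=> ma_ mb_ ma mb cv.
have half (u_ v_ : (R -> R)^nat) (u v : R -> R) :
    (forall n, measurable_fun setT (u_ n)) ->
    (forall n, measurable_fun setT (v_ n)) ->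
    measurable_fun setT u -> measurable_fun setT v ->
    (\int[leb R]_w ((u_ n w - u w) ^+ 2 + (v_ n w - v w) ^+ 2)%:E)%E
      @[n --> \oo] --> 0%E -> L2cvg u_ u.
  move=> mu_ mv_ mu mv {}cv.
  have md n : measurable_fun setT (fun w => (u_ n w - u w) ^+ 2).
    by apply: measurable_funX; exact: measurable_funB.
  have me n : measurable_fun setT (fun w => (v_ n w - v w) ^+ 2).
    by apply: measurable_funX; exact: measurable_funB.
  have le n : (\int[leb R]_w ((u_ n w - u w) ^+ 2)%:E <=
      \int[leb R]_w ((u_ n w - u w) ^+ 2 + (v_ n w - v w) ^+ 2)%:E)%E.
    apply: ge0_le_integral => //.
    - by move=> w _; rewrite lee_fin sqr_ge0.
    - by have /measurable_EFinP := md n.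
    - by have /measurable_EFinP := measurable_funD (md n) (me n).
    - by move=> w _; rewrite lee_fin lerDl sqr_ge0.
  have cvu : (\int[leb R]_w ((u_ n w - u w) ^+ 2)%:E)%E @[n --> \oo] --> 0%E.
    apply: (@squeeze_cvge _ _ _ _ (cst 0%E) _ _ _ _ _ cv); last exact: cvg_cst.
    apply: nearW => n; rewrite le andbT.
    by apply: integral_ge0 => w _; rewrite lee_fin sqr_ge0.
  split; last exact: (fine_cvg cvu).
  have /fine_cvgP[+ _] := cvu; apply: filterS => n fn.
  apply/Lfun2P; split; first exact: (measurable_funB (mu_ n) mu).
  apply/integrableP; split; first by have /measurable_EFinP := md n.
  under eq_integral do rewrite /= ger0_norm ?sqr_ge0//.
  by rewrite ltey_eq fn.
split; first exact: (half _ b_ _ b).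
apply: (half _ a_ _ a) => //.
by under eq_fun do under eq_integral do rewrite addrC.
Qed.

Lemma fourier_L2cvg f F : is_fourier f F ->
  L2cvg (fun n => cos_transform (cutoff n%:R f)) (fun w => complex.Re (F w)) /\
  L2cvg (fun n w => - sin_transform (cutoff n%:R f) w) (fun w => complex.Im (F w)).
Proof.
move=> [f2 ReF2 ImF2 cvF].
have mf : measurable_fun setT f by have [] := (Lfun2P (leb R) f).1 f2.
have mfn n : measurable_fun setT (cutoff n%:R f) by exact: measurable_cutoff.
apply: L2cvg_of_sum_squares.
- by move=> n; exact: measurable_cos_transform.
- move=> n; have mopp : measurable_fun setT (fun x : R => - x).
    by apply: continuous_measurable_fun; exact: opp_continuous.
  exact: (measurableT_comp mopp (measurable_sin_transform (mfn n))).
- by have [] := (Lfun2P (leb R) _).1 ReF2.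
- by have [] := (Lfun2P (leb R) _).1 ImF2.
have /= := cvg_comp _ _ (@cvgr_idn R) cvF.
apply: cvg_trans; apply: near_eq_cvg; apply: nearW => n.
by apply: eq_integral => w _; rewrite truncated_fourierE//; case: (F w).
Qed.

(** The formula passes from the cut-off functions to the limit: on the frequency
    side by convergence of the truncated transforms in L2, and on the time side
    by dominated convergence. *)
Lemma plancherel_corr f g F G tau : is_fourier f F -> is_fourier g G ->
  \int[leb R]_w cross_spectrum (complex.Re (F w)) (complex.Im (F w))
    (complex.Re (G w)) (complex.Im (G w)) (tau * w) =
  2 * pi * corr f g tau.
Proof.
move=> fF gG; have [f2 ReF2 ImF2 _] := fF; have [g2 ReG2 ImG2 _] := gG.
have [cF sF] := fourier_L2cvg fF; have [cG sG] := fourier_L2cvg gG.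
pose cf n := cos_transform (cutoff n%:R f).
pose sf n w := - sin_transform (cutoff n%:R f) w.
pose cg n := cos_transform (cutoff n%:R g).
pose sg n w := - sin_transform (cutoff n%:R g) w.
(* The distance of u_ n to the square-integrable u is finite for n large. *)
have near_L2 (u_ : (R -> R)^nat) (u : R -> R) : u \in Lfun (leb R) 2%:E ->
    L2cvg u_ u -> \forall n \near \oo, u_ n \in Lfun (leb R) 2%:E.
  move=> u2 [du _]; apply: filterS du => n dun.
  rewrite (_ : u_ n = fun w => (u_ n w - u w) + u w); last first.
    by apply/funext => w; rewrite subrK.
  exact: (Lfun2_add dun u2).
have ncf := near_L2 _ _ ReF2 cF; have nsf := near_L2 _ _ ImF2 sF.
have ncg := near_L2 _ _ ReG2 cG; have nsg := near_L2 _ _ ImG2 sG.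
have opp_L2 (u_ : (R -> R)^nat) :
    (\forall n \near \oo, (fun w => - u_ n w) \in Lfun (leb R) 2%:E) ->
    \forall n \near \oo, u_ n \in Lfun (leb R) 2%:E.
  apply: filterS => n un.
  rewrite (_ : u_ n = fun w => - u_ n w * (- 1)); last first.
    by apply/funext => w; rewrite mulrN1 opprK.
  apply: (Lfun2_bounded_mul un (b := fun=> - 1)) => [|w].
    exact: measurable_cst.
  by rewrite normrN1.
have split_int (a1 a2 b1 b2 : R -> R) : a1 \in Lfun (leb R) 2%:E ->
    a2 \in Lfun (leb R) 2%:E -> b1 \in Lfun (leb R) 2%:E ->
    b2 \in Lfun (leb R) 2%:E ->
    \int[leb R]_w cross_spectrum (a1 w) (a2 w) (b1 w) (b2 w) (tau * w) =
    \int[leb R]_w (a1 w * b1 w * cos (tau * w)) +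
    \int[leb R]_w (a2 w * b2 w * cos (tau * w)) +
    (\int[leb R]_w (a1 w * b2 w * sin (tau * w)) -
     \int[leb R]_w (a2 w * b1 w * sin (tau * w))).
  move=> a12 a22 b12 b22.
  have i1 := integrable_mul_cos tau (Lfun2_mul a12 b12).
  have i2 := integrable_mul_cos tau (Lfun2_mul a22 b22).
  have i3 := integrable_mul_sin tau (Lfun2_mul a12 b22).
  have i4 := integrable_mul_sin tau (Lfun2_mul a22 b12).
  rewrite -RintegralB// -RintegralD// -RintegralD//; last 2 first.
    exact: integrable_addr.
    exact: integrable_subr.
  by apply: eq_Rintegral => w _; rewrite /cross_spectrum; ring.
have lhs : \int[leb R]_w cross_spectrum (cf n w) (sf n w) (cg n w) (sg n w)
    (tau * w) @[n --> \oo] -->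
    \int[leb R]_w cross_spectrum (complex.Re (F w)) (complex.Im (F w))
      (complex.Re (G w)) (complex.Im (G w)) (tau * w).
  rewrite split_int//.
  have mc := measurable_cosM tau; have ms := measurable_sinM tau.
  have bc (w : R) := cos_max (tau * w); have bs (w : R) := sin_max (tau * w).
  have c1 := L2cvg_pairing ReF2 ReG2 cF cG mc bc.
  have c2 := L2cvg_pairing ImF2 ImG2 sF sG mc bc.
  have c3 := L2cvg_pairing ReF2 ImG2 cF sG ms bs.
  have c4 := L2cvg_pairing ImF2 ReG2 sF cG ms bs.
  apply: cvg_trans (cvgD (cvgD c1 c2) (cvgB c3 c4)).
  apply: near_eq_cvg; near=> n; rewrite split_int//; near: n.
  - exact: ncf.
  - exact: nsf.
  - exact: ncg.
  - exact: nsg.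
have rhs : \int[leb R]_w cross_spectrum (cf n w) (sf n w) (cg n w) (sg n w)
    (tau * w) @[n --> \oo] --> 2 * pi * corr f g tau.
  have cv : corr (cutoff n%:R f) (cutoff n%:R g) tau @[n --> \oo] -->
      corr f g tau.
    have pw (h : R -> R) (x : R) : cutoff n%:R h x @[n --> \oo] --> h x.
      apply: cvg_near_cst; near=> n.
      rewrite /cutoff indicE mem_set ?mulr1//= in_itv/= -ler_norml.
      by near: n; exact: nbhs_infty_ger.
    have mf : measurable_fun setT f by have [] := (Lfun2P (leb R) f).1 f2.
    have mg : measurable_fun setT g by have [] := (Lfun2P (leb R) g).1 g2.
    apply: (real_dominated_convergence (mu := leb R)
      (g := fun y => `|f (y + tau) * g y|)
      (f_ := fun n y => cutoff n%:R f (y + tau) * cutoff n%:R g y)).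
    - move=> n; apply: measurable_funM; last exact: measurable_cutoff.
      by apply: measurable_translate; exact: measurable_cutoff.
    - by move=> y; apply: cvgM; exact: pw.
    - exact: integrable_norm (integrable_corr tau f2 g2).
    - move=> n y; rewrite normrM [leRHS]normrM.
      by apply: ler_pM => //; exact: norm_cutoff_le.
  have cv2 : 2 * pi * corr (cutoff n%:R f) (cutoff n%:R g) tau @[n --> \oo] -->
      2 * pi * corr f g tau by apply: cvgMr.
  apply: cvg_trans cv2.
  apply: near_eq_cvg; near=> n; apply/esym/parseval_cutoff => //; near: n.
  - exact: ncf.
  - exact: opp_L2 nsf.
  - exact: ncg.
  - exact: opp_L2 nsg.
exact: (cvg_unique _ lhs rhs).
Unshelve. all: by end_near. Qed.

End fourier_transform.

(** * Correlations and the Hilbert transform *)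

Lemma ae_eq_Rintegral d (T : measurableType d) (R : realType)
    (mu : {measure set T -> \bar R}) (f g : T -> R) :
  measurable_fun setT f -> measurable_fun setT g ->
  {ae mu, forall x, f x = g x} -> \int[mu]_x f x = \int[mu]_x g x.
Proof.
move=> mf mg fg; congr fine; apply: ae_eq_integral => //.
- exact/measurable_EFinP.
- exact/measurable_EFinP.
- by apply: filterS fg => x -> _.
Qed.

(** Multiplying by -i * sign w preserves the modulus, and conjugating it changes
    its sign: the first fact equates the two autocorrelations, the second makes
    the cross-correlation change sign when its factors are exchanged. *)
Lemma corr_hilbert (R : realType) (f fH : R -> R) (s : R) :
  is_hilbert_transform f fH ->
  corr fH fH s = corr f f s /\ corr fH f s = - corr f fH s.
Proof.
move=> [F [FH [fF fFH FHE]]].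
have [_ ReF2 ImF2 _] := fF; have [_ ReFH2 ImFH2 _] := fFH.
have pi2 : 2 * pi != 0 :> R by rewrite mulf_neq0 ?pnatr_eq0// gt_eqF ?pi_gt0.
have FHE' : {ae leb R, forall w, [/\ Num.sg w ^+ 2 = 1,
    complex.Re (FH w) = Num.sg w * complex.Im (F w) &
    complex.Im (FH w) = - (Num.sg w * complex.Re (F w))]}.
  have ae0 : {ae leb R, forall w, w != 0}.
    have : (leb R).-negligible [set 0 : R].
      by apply/negligibleP => //; exact: lebesgue_measure_set1.
    by apply: negligibleS => w /=; apply: contra_notP => /eqP.
  apply: (@filterS2 _ _ (ae_filter_ringOfSetsType (leb R)) _ _ _ _ FHE ae0).
  move=> w -> w0; split.
  - by rewrite sqr_sg w0.
  - by case: (F w) => a b /=; ring.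
  - by case: (F w) => a b /=; ring.
have ms a1 a2 b1 b2 a12 a22 b12 b22 := integrable_measurable
  (@integrable_cross_spectrum R a1 a2 b1 b2 s a12 a22 b12 b22).
split; apply: (mulfI pi2).
  rewrite -(plancherel_corr s fFH fFH) -(plancherel_corr s fF fF).
  apply: ae_eq_Rintegral; [exact: ms|exact: ms|].
  apply: (@filterS _ _ (ae_filter_ringOfSetsType (leb R)) _ _ _ FHE').
  move=> w [sg1 -> ->]; rewrite /cross_spectrum.
  transitivity (Num.sg w ^+ 2 * (complex.Re (F w) * complex.Re (F w) +
    complex.Im (F w) * complex.Im (F w)) * cos (s * w)); first by ring.
  by rewrite sg1; ring.
rewrite mulrN -(plancherel_corr s fFH fF) -(plancherel_corr s fF fFH).
rewrite -mulN1r -RintegralZl//; last exact: integrable_cross_spectrum.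
apply: ae_eq_Rintegral; first exact: ms.
  by apply: measurable_funM => //; exact: ms.
apply: (@filterS _ _ (ae_filter_ringOfSetsType (leb R)) _ _ _ FHE').
by move=> w [_ -> ->]; rewrite /cross_spectrum; ring.
Qed.

(** * Second moments of linear statistics of a random field *)

Section product_integrals.
Context d1 d2 (T1 : measurableType d1) (T2 : measurableType d2) (R : realType).
Variable m1 : {sigma_finite_measure set T1 -> \bar R}.
Variable m2 : {sigma_finite_measure set T2 -> \bar R}.

Lemma Rintegral_prod (f : T1 * T2 -> R) :
  (m1 \x m2)%E.-integrable setT (EFin \o f) ->
  \int[(m1 \x m2)%E]_p f p = \int[m1]_x \int[m2]_y f (x, y).
Proof.
by move=> fi; rewrite (real_fubini1 fi).2 /Rintegral -(integral12_prod_meas1 fi).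
Qed.

Lemma Rintegral_prod_mul (u : T1 -> R) (v : T2 -> R) :
  m1.-integrable setT (EFin \o u) -> m2.-integrable setT (EFin \o v) ->
  \int[(m1 \x m2)%E]_p (u p.1 * v p.2) = \int[m1]_x u x * \int[m2]_y v y.
Proof.
move=> ui vi; rewrite (Rintegral_prod (integrable_prod ui vi))/=.
rewrite -RintegralZr//; apply: eq_Rintegral => x _.
by rewrite RintegralZl.
Qed.

End product_integrals.

Section product_sigma_finite.
Context d1 d2 (T1 : measurableType d1) (T2 : measurableType d2) (R : realType).
Variable m1 : {sigma_finite_measure set T1 -> \bar R}.
Variable m2 : {sigma_finite_measure set T2 -> \bar R}.

(** The rectangles F i * G j, for two covers F and G by sets of finite measure,
    form a countable cover. *)
Let product_sigma_finite : sigma_finite setT (m1 \x m2)%E.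
Proof.
have [F F_T Ffin] := sigma_finiteT m1; have [G G_T Gfin] := sigma_finiteT m2.
pose pairs n : set (T1 * T2) :=
  if unpickle n is Some (i, j) then F i `*` G j else set0.
exists pairs => [|n].
  apply/esym/seteqP; split=> // -[x y] _.
  have [i _ Fi] : (\bigcup_i F i) x by rewrite -F_T.
  have [j _ Gj] : (\bigcup_j G j) y by rewrite -G_T.
  by exists (pickle (i, j)) => //; rewrite /pairs pickleK.
rewrite /pairs; case: unpickle => [[i j]|]; last by rewrite measure0.
have [mF Fy] := Ffin i; have [mG Gy] := Gfin j.
split; first exact: measurableX.
by rewrite product_measure1E// lte_mul_pinfty// ge0_fin_numE.
Qed.

Definition sigma_finite_product :
    {sigma_finite_measure set (T1 * T2)%type -> \bar R} :=
  HB.pack (m1 \x m2)%E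
    (Measure_isSigmaFinite.Build _ _ _ (m1 \x m2)%E product_sigma_finite).

End product_sigma_finite.

Section second_moment.
Context dX (X : measurableType dX) (R : realType).
Variable mu : {sigma_finite_measure set X -> \bar R}.
Context d (T : measurableType d) (P : probability T R).
Variable n : X -> T -> R.
Hypothesis mn : measurable_fun [set: X * T] (fun p => n p.1 p.2).
Hypothesis n2 : forall x, n x \in Lfun P 2%:E.
Implicit Types phi : X -> R.

Definition moment_integrable phi phi' :=
  (\int[mu]_x \int[mu]_y
     ('E_P[fun t => `|n x t * n y t|%R] * (`|phi x| * `|phi' y|)%:E) < +oo)%E.

Let mumu := sigma_finite_product mu mu.

(** The integrand of the product of the statistics of phi and phi'. *)
Let K phi phi' (q : T * (X * X)) : R :=
  (n q.2.1 q.1 * phi q.2.1) * (n q.2.2 q.1 * phi' q.2.2).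

Let mnx x : measurable_fun setT (n x).
Proof. exact: (@measurable_fun_pair2 _ _ _ X T _ _ x mn). Qed.

Let mnt t : measurable_fun setT (n^~ t).
Proof. exact: (@measurable_fun_pair1 _ _ _ X T _ _ t mn). Qed.

Let mK phi phi' : measurable_fun setT phi -> measurable_fun setT phi' ->
  measurable_fun setT (K phi phi').
Proof.
move=> mp mp'.
have m1 : measurable_fun setT (fun q : T * (X * X) => n q.2.1 q.1).
  exact: (measurableT_comp mn (measurable_fun_pair
    (measurableT_comp (@measurable_fst _ _ X X) (@measurable_snd _ _ T (X * X)%type))
    (@measurable_fst _ _ T (X * X)%type))).
have m2 : measurable_fun setT (fun q : T * (X * X) => n q.2.2 q.1).
  exact: (measurableT_comp mn (measurable_fun_pair
    (measurableT_comp (@measurable_snd _ _ X X) (@measurable_snd _ _ T (X * X)%type))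
    (@measurable_fst _ _ T (X * X)%type))).
apply: measurable_funM; apply: measurable_funM => //.
  exact: (measurableT_comp mp (measurableT_comp measurable_fst measurable_snd)).
exact: (measurableT_comp mp' (measurableT_comp measurable_snd measurable_snd)).
Qed.

Let integrable_K phi phi' : measurable_fun setT phi ->
  measurable_fun setT phi' -> moment_integrable phi phi' ->
  (P \x mumu)%E.-integrable setT (EFin \o K phi phi').
Proof.
move=> mp mp' fin.
have mEK : measurable_fun setT (EFin \o K phi phi').
  by apply/measurable_EFinP; exact: mK.
apply/(integrable21ltyP P mumu mEK).
rewrite (fubini_tonelli1 (fun p => \int[P]_t `|(EFin \o K phi phi') (t, p)|)%E).
- apply: le_lt_trans fin; rewrite le_eqVlt; apply/orP; left; apply/eqP.
  apply: eq_integral => x _; apply: eq_integral => y _.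
  rewrite unlock -ge0_integralZr//; last first.
    apply/measurable_EFinP; apply: measurableT_comp => //.
    by apply: measurable_funM; exact: mnx.
  apply: eq_integral => t _; rewrite /K/= -EFinM; congr EFin.
  by rewrite !normrM mulrACA.
- apply: (measurable_fun_fubini_tonelli_G (m1 := P)
    (abse \o (EFin \o K phi phi'))) => //.
    exact: measurableT_comp.
  by move=> p; exact: abse_ge0.
- by move=> p; apply: integral_ge0 => t _; exact: abse_ge0.
Qed.

(** The square of the integral of |n x t * phi x| has finite expectation, so this
    integral is finite for almost every t. *)
Let slice_integrable phi : measurable_fun setT phi ->
  moment_integrable phi phi ->
  {ae P, forall t, mu.-integrable setT (EFin \o (fun x => n x t * phi x))}.
Proof.
move=> mp fin; have Ki := integrable_K mp mp fin.
have := ae_integrable1 Ki.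
apply: (@filterS _ _ (ae_filter_ringOfSetsType P)) => t.
pose u x := n x t * phi x; have mu_ : measurable_fun setT u.
  by apply: measurable_funM => //; exact: mnt.
move=> Kt; apply/integrableP; split; first exact/measurable_EFinP.
have /integrable12ltyP := Kt => /(_ (measurable_int _ Kt)).
rewrite -[X in (X < _)%E]/(\int[mu]_x \int[mu]_y `|(u x * u y)%:E|)%E.
rewrite ge0_integral_prod_mul//; rewrite !ltey; apply: contra_neq.
by move=> ->; rewrite mulyy.
Qed.

(** Exchanging the expectation and the two space integrals in the second moment
    of linear statistics of the field.  The two diagonal conditions make the
    statistics absolutely convergent almost surely, the mixed one lets the
    order of integration be changed. *)
Lemma second_moment_Fubini phi phi' :
  measurable_fun setT phi -> measurable_fun setT phi' ->
  moment_integrable phi phi -> moment_integrable phi' phi' ->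
  moment_integrable phi phi' ->
  let c t := \int[mu]_x (n x t * phi x) in
  let c' t := \int[mu]_x (n x t * phi' x) in
  let H p := (\int[P]_t (n p.1 t * n p.2 t)) * (phi p.1 * phi' p.2) in
  [/\ P.-integrable setT (EFin \o (fun t => c t * c' t)),
      (mu \x mu)%E.-integrable setT (EFin \o H) &
      \int[P]_t (c t * c' t) = \int[(mu \x mu)%E]_p H p].
Proof.
move=> mp mp' fin fin' finm c c' H.
have Ki := integrable_K mp mp' finm.
have mstat psi : measurable_fun setT psi ->
    measurable_fun setT (fun t => \int[mu]_x (n x t * psi x)).
  move=> mpsi.
  apply: (measurable_Rintegral2 mu (f := fun q : X * T => n q.1 q.2 * psi q.1)).
  apply: measurable_funM => //.
  exact: (measurableT_comp mpsi measurable_fst).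
have mcc : measurable_fun setT (fun t => c t * c' t).
  by apply: measurable_funM; exact: mstat.
have [KPi KPE] := real_fubini1 Ki.
have ae : {ae P, forall t,
    c t * c' t = \int[mumu]_p K phi phi' (t, p)}.
  apply: (@filterS2 _ _ (ae_filter_ringOfSetsType P) _ _ _ _
    (slice_integrable mp fin) (slice_integrable mp' fin')) => t it it'.
  by rewrite -Rintegral_prod_mul.
have mKP := integrable_measurable KPi.
have KH p : \int[P]_t K phi phi' (t, p) = H p.
  rewrite /K/= /H; under eq_Rintegral do rewrite mulrACA.
  by rewrite RintegralZr//; exact: Lfun2_mul.
split.
  have /integrableP[_] := KPi => Kfin.
  apply/integrableP; split; first exact/measurable_EFinP.
  apply: le_lt_trans Kfin; rewrite le_eqVlt; apply/orP; left; apply/eqP.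
  apply: ae_eq_integral => //.
  - by apply: measurableT_comp => //; exact/measurable_EFinP.
  - by apply: measurableT_comp => //; exact/measurable_EFinP.
  - apply: (@filterS _ _ (ae_filter_ringOfSetsType P) _ _ _ ae) => t E _ /=.
    by rewrite E.
  by have := real_fubini2 Ki; apply: eq_integrable => // p _ /=; rewrite KH.
rewrite (ae_eq_Rintegral mcc mKP ae) (real_fubini Ki).
by apply: eq_Rintegral => p _; exact: KH.
Qed.

End second_moment.

(** * Covariances under stationarity *)

Section plane_translation.
Context (R : realType).
Let RR := (measurableTypeR R * measurableTypeR R)%type.

Lemma measurable_translate2 (a : R * R) :
  measurable_fun setT (fun x : RR => (x.1 + a.1, x.2 + a.2) : RR).
Proof.
have m1 (b : R) : measurable_fun setT (fun x : R => x + b).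
  by apply: continuous_measurable_fun => x; apply: cvgD; [exact: cvg_id|exact: cvg_cst].
apply: measurable_fun_pair.
  exact: (measurableT_comp (m1 a.1) measurable_fst).
exact: (measurableT_comp (m1 a.2) measurable_snd).
Qed.

Lemma ge0_integral_translate2 (F : RR -> \bar R) (a : R * R) :
  measurable_fun setT F -> (forall x, 0 <= F x)%E ->
  (\int[leb2 R]_x F (x.1 + a.1, x.2 + a.2)%R = \int[leb2 R]_x F x)%E.
Proof.
move=> mF F0.
rewrite (fubini_tonelli1 (fun x : RR => F (x.1 + a.1, x.2 + a.2)%R))//; last first.
  exact: (measurableT_comp mF (measurable_translate2 a)).
rewrite (fubini_tonelli1 F)// /fubini_F/=.
have mG := measurable_fun_fubini_tonelli_F (m2 := leb R) F mF F0.
rewrite [RHS](ge0_integral_affine a.1 ltr01 mG) ?mul1e; last first.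
  by move=> x; exact: integral_ge0.
apply: eq_integral => x _; rewrite /fubini_F mul1r.
rewrite [RHS](ge0_integral_affine a.2 ltr01) ?mul1e//.
  by apply: eq_integral => y _; rewrite mul1r.
exact: (measurable_fun_pair2 _ mF).
Qed.

Lemma Rintegral_translate2 (F : RR -> R) (a : R * R) : measurable_fun setT F ->
  \int[leb2 R]_x F (x.1 + a.1, x.2 + a.2) = \int[leb2 R]_x F x.
Proof.
move=> /measurable_EFinP mF; congr fine.
rewrite integralE [RHS]integralE; congr (_ - _)%E.
  rewrite -[RHS](ge0_integral_translate2 a (measurable_funepos mF) (funepos_ge0 _)).
  by apply: eq_integral => x _; rewrite !funeposE.
rewrite -[RHS](ge0_integral_translate2 a (measurable_funeneg mF) (funeneg_ge0 _)).
by apply: eq_integral => x _; rewrite !funenegE.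
Qed.

End plane_translation.

Section covariance.
Context (R : realType) d (T : measurableType d) (P : probability T R).
Variable n : R * R -> T -> R.
Hypothesis mn : jointly_measurable n.
Hypothesis n_wss : wide_sense_stationary P n.
Let RR := (measurableTypeR R * measurableTypeR R)%type.
Implicit Types phi : R * R -> R.

Definition autocov (z : R * R) : R := \int[P]_t (n z t * n 0 t).

Definition corr2 phi phi' (z : R * R) : R :=
  \int[leb2 R]_y (phi (y.1 + z.1, y.2 + z.2) * phi' y).

Lemma autocovE (x y : R * R) : \int[P]_t (n x t * n y t) = autocov (x - y).
Proof.
have [_ _ /(_ y (x - y))] := n_wss.
rewrite /cov unlock => /(congr1 fine).
by rewrite addrC subrK.
Qed.

Let n2 x : n x \in Lfun P 2%:E. Proof. by have [] := n_wss. Qed.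

Lemma measurable_autocov : measurable_fun [set: RR] autocov.
Proof.
apply: (measurable_Rintegral1 P (f := fun q : RR * T => n q.1 q.2 * n 0 q.2)).
apply: measurable_funM; first exact: mn.
apply: (@measurableT_comp _ _ _ _ _ _ (n 0) _ snd); last exact: measurable_snd.
exact: (@measurable_fun_pair2 _ _ _ RR T _ _ 0 mn).
Qed.

(** Stationarity turns the double integral of the second moment into a single
    integral over the lag, in which the two analyzing functions enter only
    through their correlation. *)
Lemma covariance_formula phi phi' :
  measurable_fun [set: RR] phi -> measurable_fun [set: RR] phi' ->
  fubini_condition P n phi phi -> fubini_condition P n phi' phi' ->
  fubini_condition P n phi phi' ->
  (forall z : R * R, (leb2 R).-integrable [set: RR]
     (EFin \o (fun y => phi (y.1 + z.1, y.2 + z.2) * phi' y))) ->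
  let c t := \int[leb2 R]_x (n x t * phi x) in
  let c' t := \int[leb2 R]_x (n x t * phi' x) in
  P.-integrable setT (EFin \o (fun t => c t * c' t)) /\
  \int[P]_t (c t * c' t) = \int[leb2 R]_z (autocov z * corr2 phi phi' z).
Proof.
move=> mp mp' fin fin' finm ip c c'.
pose mu := sigma_finite_product (leb R) (leb R).
have [ci Ji ->] := second_moment_Fubini (mu := mu) mn n2 mp mp' fin fin' finm.
split=> //.
pose H (p : RR * RR) : R := autocov (p.1 - p.2) * (phi p.1 * phi' p.2).
pose H' (p : RR * RR) : R :=
  autocov p.1 * (phi (p.2.1 + p.1.1, p.2.2 + p.1.2) * phi' p.2).
have Hi : (mu \x mu)%E.-integrable setT (EFin \o H).
  by apply: eq_integrable Ji => // p _; rewrite /= autocovE.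
have mH : measurable_fun setT H := integrable_measurable Hi.
have mH' : measurable_fun setT H'.
  apply: measurable_funM.
    exact: (measurableT_comp measurable_autocov measurable_fst).
  apply: measurable_funM; last exact: (measurableT_comp mp' measurable_snd).
  have mz : measurable_fun setT (fun p : RR * RR =>
      (p.2.1 + p.1.1, p.2.2 + p.1.2) : RR).
    have m11 := measurableT_comp (@measurable_fst _ _ R R)
      (@measurable_fst _ _ RR RR).
    have m12 := measurableT_comp (@measurable_snd _ _ R R)
      (@measurable_fst _ _ RR RR).
    have m21 := measurableT_comp (@measurable_fst _ _ R R)
      (@measurable_snd _ _ RR RR).
    have m22 := measurableT_comp (@measurable_snd _ _ R R)
      (@measurable_snd _ _ RR RR).
    by apply: measurable_fun_pair; apply: measurable_funD.
  exact: (measurableT_comp mp mz).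
have HH' (y z : RR) : H ((z.1 + y.1, z.2 + y.2), y) = H' (z, y).
  case: y z => y1 y2 [z1 z2]; rewrite /H /H'/= [_ - _](_ : _ = (z1, z2)).
    by rewrite (addrC y1) (addrC y2).
  by rewrite -[LHS]/(z1 + y1 - y1, z2 + y2 - y2) !addrK.
have mHy y : measurable_fun [set: RR] (fun x => H (x, y)).
  exact: (@measurable_fun_pair1 _ _ _ RR RR _ _ y mH).
have H'i : (mu \x mu)%E.-integrable setT (EFin \o H').
  apply/integrable21ltyP; first exact/measurable_EFinP.
  have /integrable21ltyP := Hi => /(_ (measurable_int _ Hi)).
  apply: le_lt_trans; rewrite le_eqVlt; apply/orP; left; apply/eqP.
  apply: eq_integral => y _.
  have mabs : measurable_fun [set: RR] (fun x => `|(H (x, y))%:E|%E).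
    by apply: measurableT_comp => //; exact/measurable_EFinP.
  rewrite -[RHS](ge0_integral_translate2 y mabs (fun=> abse_ge0 _)).
  by apply: eq_integral => z _; rewrite HH'.
transitivity (\int[(mu \x mu)%E]_p H p).
  by apply: eq_Rintegral => p _; rewrite autocovE.
rewrite (Rintegral_prod Hi) (real_fubini Hi).
transitivity (\int[mu]_y \int[mu]_z H' (z, y)).
  apply: eq_Rintegral => y _; rewrite -[LHS](Rintegral_translate2 y (mHy y)).
  by apply: eq_Rintegral => z _; rewrite HH'.
rewrite -(real_fubini H'i); apply: eq_Rintegral => z _.
by rewrite /H'/= RintegralZl//; exact: ip.
Qed.

End covariance.

(** * Covariance of the analysis coefficients *)

Section analyzing_functions.
Context (R : realType) (M : nat) (j : int).
Hypothesis M0 : (0 < M)%N.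
Let RR := (measurableTypeR R * measurableTypeR R)%type.
Let a : R := (M%:R : R) ^ (- j).
Implicit Types (f g : R -> R) (k : int * int).

Let a0 : 0 < a. Proof. by rewrite exprz_gt0 ?ltr0n. Qed.

Lemma measurable_analyzing f1 f2 k :
  measurable_fun setT f1 -> measurable_fun setT f2 ->
  measurable_fun [set: RR] (analyzing M j f1 f2 k).
Proof.
move=> mf1 mf2.
have maff (m : int) : measurable_fun setT (fun x : R => a * x - m%:~R).
  apply: continuous_measurable_fun => x.
  by apply: cvgD; [exact: mulrl_continuous|exact: cvg_cst].
apply: measurable_funM.
  apply: measurable_funM => //.
  exact: (measurableT_comp mf1 (measurableT_comp (maff k.1) measurable_fst)).
exact: (measurableT_comp mf2 (measurableT_comp (maff k.2) measurable_snd)).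
Qed.

Let corr_scaled f g (m m' : int) (z : R) : f \in Lfun (leb R) 2%:E ->
  g \in Lfun (leb R) 2%:E ->
  (leb R).-integrable setT (EFin \o
    (fun y => f (a * (y + z) - m%:~R) * g (a * y - m'%:~R))) /\
  a * \int[leb R]_y (f (a * (y + z) - m%:~R) * g (a * y - m'%:~R)) =
  corr f g (a * z - (m - m')%:~R).
Proof.
move=> f2 g2; set s := a * z - _; have fgi := integrable_corr s f2 g2.
have E y : f (a * (y + z) - m%:~R) * g (a * y - m'%:~R) =
    f (a * y + - m'%:~R + s) * g (a * y + - m'%:~R).
  by congr (f _ * _); rewrite /s intrB; ring.
split.
  have := integrable_affine (- m'%:~R) a0 fgi.
  by apply: eq_integrable => // y _ /=; rewrite E.
rewrite /corr (Rintegral_affine (- m'%:~R) a0 fgi); congr (_ * _).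
by apply: eq_Rintegral => y _; rewrite E.
Qed.

(** The factors M^-j of the two analyzing functions compensate the two
    changes of variable u = M^-j y - k'. *)
Lemma corr2_analyzing f1 f2 g1 g2 k k' (z : R * R) :
  f1 \in Lfun (leb R) 2%:E -> f2 \in Lfun (leb R) 2%:E ->
  g1 \in Lfun (leb R) 2%:E -> g2 \in Lfun (leb R) 2%:E ->
  (leb2 R).-integrable [set: RR] (EFin \o (fun y =>
    analyzing M j f1 f2 k (y.1 + z.1, y.2 + z.2) * analyzing M j g1 g2 k' y)) /\
  corr2 (analyzing M j f1 f2 k) (analyzing M j g1 g2 k') z =
  corr f1 g1 (a * z.1 - (k.1 - k'.1)%:~R) *
  corr f2 g2 (a * z.2 - (k.2 - k'.2)%:~R).
Proof.
move=> f12 f22 g12 g22.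
have [u1i <-] := corr_scaled k.1 k'.1 z.1 f12 g12.
have [u2i <-] := corr_scaled k.2 k'.2 z.2 f22 g22.
set u1 := fun y => _ in u1i *; set u2 := fun y => _ in u2i *.
have E (y : R * R) : analyzing M j f1 f2 k (y.1 + z.1, y.2 + z.2) *
    analyzing M j g1 g2 k' y = (a * u1 y.1) * (a * u2 y.2).
  by rewrite /analyzing /u1 /u2 /= -/a; ring.
have v1i := integrable_mulrl a u1i; have v2i := integrable_mulrl a u2i.
split.
  by have := integrable_prod v1i v2i; apply: eq_integrable => // y _ /=; rewrite E.
rewrite /corr2 -(RintegralZl a measurableT u1i) -(RintegralZl a measurableT u2i).
rewrite -[RHS](Rintegral_prod_mul v1i v2i).
by apply: eq_Rintegral => y _; rewrite E.
Qed.

End analyzing_functions.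

Section coefficient_covariance.
Context (R : realType) d (T : measurableType d) (P : probability T R).
Variables (M : nat) (j : int) (n : R * R -> T -> R).
Hypothesis M0 : (0 < M)%N.
Hypothesis mn : jointly_measurable n.
Hypothesis n_wss : wide_sense_stationary P n.
Implicit Types (f g : R -> R) (k l : int * int).

(** The covariance at lag l of the coefficients of n on (f1, f2) and on
    (g1, g2); see coef_moment. *)
Definition coef_cov f1 f2 g1 g2 l : R :=
  \int[leb2 R]_z (autocov P n z *
    (corr f1 g1 ((M%:R : R) ^ (- j) * z.1 - l.1%:~R) *
     corr f2 g2 ((M%:R : R) ^ (- j) * z.2 - l.2%:~R))).

Lemma coef_moment f1 f2 g1 g2 k k' :
  f1 \in Lfun (leb R) 2%:E -> f2 \in Lfun (leb R) 2%:E ->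
  g1 \in Lfun (leb R) 2%:E -> g2 \in Lfun (leb R) 2%:E ->
  let phi := analyzing M j f1 f2 k in let phi' := analyzing M j g1 g2 k' in
  fubini_condition P n phi phi -> fubini_condition P n phi' phi' ->
  fubini_condition P n phi phi' ->
  P.-integrable setT
    (EFin \o (fun t => coef n M j f1 f2 k t * coef n M j g1 g2 k' t)) /\
  \int[P]_t (coef n M j f1 f2 k t * coef n M j g1 g2 k' t) =
  coef_cov f1 f2 g1 g2 (k - k').
Proof.
move=> f12 f22 g12 g22 phi phi' fin fin' finm.
have meas f : f \in Lfun (leb R) 2%:E -> measurable_fun setT f.
  by move=> /Lfun2P[].
have mphi : measurable_fun setT phi.
  by apply: measurable_analyzing; exact: meas.
have mphi' : measurable_fun setT phi'.
  by apply: measurable_analyzing; exact: meas.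
have cE z := corr2_analyzing j M0 k k' z f12 f22 g12 g22.
have [ci cint] := covariance_formula mn n_wss mphi mphi' fin fin' finm
  (fun z => (cE z).1).
split; first exact: ci.
rewrite [LHS]cint; apply: eq_Rintegral => z _.
by rewrite (cE z).2.
Qed.

End coefficient_covariance.

(** * The linear combinations of the primal and dual coefficients *)

Section packet_moments.
Context d (T : measurableType d) (R : realType) (P : probability T R).

(** Polarization of the second moments of x + s y and x' + s' y'.  The
    hypotheses say that exchanging the roles of the two components does not
    change any moment, so that each of them is one of A and B. *)
Lemma integral_packet_mul (x y x' y' : T -> R) (s s' A B : R) :
  P.-integrable setT (EFin \o (fun t => x t * x' t)) ->
  P.-integrable setT (EFin \o (fun t => x t * y' t)) ->
  P.-integrable setT (EFin \o (fun t => y t * x' t)) ->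
  P.-integrable setT (EFin \o (fun t => y t * y' t)) ->
  \int[P]_t (x t * x' t) = A -> \int[P]_t (x t * y' t) = B ->
  \int[P]_t (y t * x' t) = B -> \int[P]_t (y t * y' t) = A ->
  ('E_P[fun t => ((Num.sqrt 2)^-1 * (x t + s * y t) *
                 ((Num.sqrt 2)^-1 * (x' t + s' * y' t)))%R] =
   (2^-1 * ((1 + s * s') * A + (s + s') * B))%:E)%E.
Proof.
move=> ixx ixy iyx iyy Exx Exy Eyx Eyy.
have ixy' := integrable_mulrl s' ixy; have iyx' := integrable_mulrl s iyx.
have iyy' := integrable_mulrl (s * s') iyy.
have i1 := integrable_addr ixx ixy'; have i2 := integrable_addr i1 iyx'.
have i3 := integrable_addr i2 iyy'.
have sqrt2 : (Num.sqrt 2)^-1 * (Num.sqrt 2)^-1 = 2^-1 :> R.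
  by rewrite -invfM -expr2 sqr_sqrtr.
have E t : (Num.sqrt 2)^-1 * (x t + s * y t) *
    ((Num.sqrt 2)^-1 * (x' t + s' * y' t)) =
    2^-1 * (x t * x' t + s' * (x t * y' t) + s * (y t * x' t) +
            s * s' * (y t * y' t)) by rewrite -sqrt2; ring.
rewrite unlock.
under eq_integral do rewrite E.
have i4 := integrable_mulrl 2^-1 i3.
rewrite -[LHS]fineK; last exact: (integrable_fin_num _ i4).
congr EFin; rewrite -[LHS]/(\int[P]_t _).
rewrite RintegralZl// !RintegralD// !RintegralZl// Exx Exy Eyx Eyy.
by congr (_ * _); ring.
Qed.

End packet_moments.

Theorem proposition3 (R : realType) (d : measure_display) (T : measurableType d)
  (P : probability T R) (M : nat) (psi psiH : nat -> R -> R) (j : int)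
  (n : R * R -> T -> R)
  (M_ge2 : (2 <= M)%N)
  (psi_mra : orthonormal_mra M psi)
  (psiH_hilbert : forall m : nat, (1 <= m < M)%N ->
     is_hilbert_transform (psi m) (psiH m))
  (n_meas : jointly_measurable n)
  (n_wss : wide_sense_stationary P n)
  (n_zero_mean : forall x : R * R, ('E_P[n x] = 0)%E)
  (n_fubini : forall m1 m2 : nat, (1 <= m1 < M)%N -> (1 <= m2 < M)%N ->
     forall (k k' : int * int) (g g' : nat -> R -> R),
     g = psi \/ g = psiH -> g' = psi \/ g' = psiH ->
     fubini_condition P n (analyzing M j (g m1) (g m2) k)
                          (analyzing M j (g' m1) (g' m2) k')) :
  forall m1 m2 : nat, (1 <= m1 < M)%N -> (1 <= m2 < M)%N ->
  let nm := coef n M j (psi m1) (psi m2) in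
  let nmH := coef n M j (psiH m1) (psiH m2) in
  let w := fun (k : int * int) (t : T) =>
    (Num.sqrt 2)^-1 * (nm k t + nmH k t) in
  let wH := fun (k : int * int) (t : T) =>
    (Num.sqrt 2)^-1 * (nm k t - nmH k t) in
  (* the covariance fields are well defined: independence of the base point k *)
  [/\ cov_stationary P nm nm, cov_stationary P nm nmH,
      cov_stationary P w w, cov_stationary P wH wH & cov_stationary P w wH] /\
  forall l : int * int,
  [/\ (cov P w w l = cov P nm nm l + cov P nm nmH l)%E,
      (cov P wH wH l = cov P nm nm l - cov P nm nmH l)%E &
      (cov P w wH l = 0)%E].
Proof.
move=> m1 m2 hm1 hm2 nm nmH w wH.
have M0 : (0 < M)%N by exact: leq_trans M_ge2.
have [F1 [FH1 [[p1 _ _ _] [q1 _ _ _] _]]] := psiH_hilbert m1 hm1.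
have [F2 [FH2 [[p2 _ _ _] [q2 _ _ _] _]]] := psiH_hilbert m2 hm2.
have hH1 s := corr_hilbert s (psiH_hilbert m1 hm1).
have hH2 s := corr_hilbert s (psiH_hilbert m2 hm2).
pose V f1 f2 g1 g2 := coef_cov P M j n f1 f2 g1 g2.
pose A := V (psi m1) (psi m2) (psi m1) (psi m2).
pose B := V (psi m1) (psi m2) (psiH m1) (psiH m2).
have VHH l : V (psiH m1) (psiH m2) (psiH m1) (psiH m2) l = A l.
  by apply: eq_Rintegral => z _; rewrite (hH1 _).1 (hH2 _).1.
(* The two sign changes of the one-dimensional correlations cancel. *)
have VHn l : V (psiH m1) (psiH m2) (psi m1) (psi m2) l = B l.
  by apply: eq_Rintegral => z _; rewrite (hH1 _).2 (hH2 _).2 mulrNN.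
have mom (g g' : nat -> R -> R) k k' : g = psi \/ g = psiH ->
    g' = psi \/ g' = psiH ->
    P.-integrable setT (EFin \o (fun t =>
      coef n M j (g m1) (g m2) k t * coef n M j (g' m1) (g' m2) k' t)) /\
    \int[P]_t (coef n M j (g m1) (g m2) k t * coef n M j (g' m1) (g' m2) k' t) =
    V (g m1) (g m2) (g' m1) (g' m2) (k - k').
  move=> gE g'E.
  have L2 (h : nat -> R -> R) : h = psi \/ h = psiH ->
      L2 (h m1) /\ L2 (h m2) by case=> ->.
  have [g12 g22] := L2 _ gE; have [g'12 g'22] := L2 _ g'E.
  by apply: coef_moment => //; apply: n_fubini.
have [nn nH Hn HH] : [/\
    forall k k', P.-integrable setT (EFin \o (fun t => nm k t * nm k' t)) /\
      \int[P]_t (nm k t * nm k' t) = A (k - k'),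
    forall k k', P.-integrable setT (EFin \o (fun t => nm k t * nmH k' t)) /\
      \int[P]_t (nm k t * nmH k' t) = B (k - k'),
    forall k k', P.-integrable setT (EFin \o (fun t => nmH k t * nm k' t)) /\
      \int[P]_t (nmH k t * nm k' t) = B (k - k') &
    forall k k', P.-integrable setT (EFin \o (fun t => nmH k t * nmH k' t)) /\
      \int[P]_t (nmH k t * nmH k' t) = A (k - k')].
  split=> k k'.
  - by apply: mom; left.
  - by apply: mom; [left|right].
  - by rewrite -VHn; apply: mom; [right|left].
  - by rewrite -VHH; apply: mom; right.
pose packet (s : R) (k : int * int) (t : T) : R :=
  (Num.sqrt 2)^-1 * (nm k t + s * nmH k t).
have Ew : w = packet 1.
  by apply/funext => k; apply/funext => t; rewrite /packet mul1r.
have EwH : wH = packet (- 1).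
  by apply/funext => k; apply/funext => t; rewrite /packet mulN1r.
have Epacket s s' k k' : ('E_P[fun t => (packet s k t * packet s' k' t)%R] =
    (2^-1 * ((1 + s * s') * A (k - k') + (s + s') * B (k - k')))%:E)%E.
  have [i1 e1] := nn k k'; have [i2 e2] := nH k k'.
  have [i3 e3] := Hn k k'; have [i4 e4] := HH k k'.
  exact: integral_packet_mul.
have Enn k k' : ('E_P[fun t => (nm k t * nm k' t)%R] = (A (k - k'))%:E)%E.
  have [i1 <-] := nn k k'.
  by rewrite unlock /Rintegral fineK//; exact: (integrable_fin_num _ i1).
have EnH k k' : ('E_P[fun t => (nm k t * nmH k' t)%R] = (B (k - k'))%:E)%E.
  have [i1 <-] := nH k k'.
  by rewrite unlock /Rintegral fineK//; exact: (integrable_fin_num _ i1).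
have lag (k l : int * int) : k + l - k = l by rewrite addrC addKr.
split.
  rewrite Ew EwH; split=> k l; rewrite /cov.
  - by rewrite !Enn lag subr0.
  - by rewrite !EnH lag subr0.
  - by rewrite !Epacket lag subr0.
  - by rewrite !Epacket lag subr0.
  - by rewrite !Epacket lag subr0.
move=> l; rewrite Ew EwH /cov; split; rewrite ?Enn ?EnH !Epacket subr0.
- by rewrite -EFinD; congr EFin; field.
- by rewrite -EFinB; congr EFin; field.
- by congr EFin; field.
Qed.
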